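(* Let $1\le s\le n$ and suppose $s$ algebraic hypersurfaces without multiple factors $f_1(X)=0,\dots,f_s(X)=0$ in $\mathbb{C}^n$, of degrees $k_1,\dots,k_s$ respectively, sufficiently intersect at the algebraic manifold $S=s(f_1,\dots,f_s)$. Then the set of polynomials $\{f_1,\dots,f_s\}$ is an $H$-base of the ideal $I_s=\langle f_1,\dots,f_s\rangle$ of $\mathbb{C}[x_1,\dots,x_n]$.
   Context: $X=(x_1,\dots,x_n)$. $s(f_1,\dots,f_s)$ is the set of common zeros of $f_1,\dots,f_s$ in $\mathbb{C}^n$. A hypersurface $f(X)=0$ is without multiple factors if $f$ has no repeated non-constant factor. Sufficient intersection: hypersurfaces $f_1=0,\dots,f_s=0$ of degrees $k_1,\dots,k_s$ in $\mathbb{C}^n$ ($1\le s\le n$) sufficiently intersect at $s(f_1,\dots,f_s)$ if there exist $n-s$ hypersurfaces $f_{s+1}=0,\dots,f_n=0$ of degrees $k_{s+1},\dots,k_n$ such that $f_1=0,\dots,f_n=0$ meet exactly at $k_1\cdots k_n$ mutually distinct points of $\mathbb{C}^n$. $H$-base: a set $G=\{g_1,\dots,g_s\}\subset\mathbb{C}[x_1,\dots,x_n]\setminus\{0\}$ is an $H$-base of the ideal $I=\langle g_1,\dots,g_s\rangle$ if for each $p\in I$ there exist $h_1,\dots,h_s\in\mathbb{C}[x_1,\dots,x_n]$ with $p=\sum_{i=1}^s h_ig_i$ and $\deg(h_i)+\deg(g_i)\le\deg(p)$ for $i=1,\dots,s$ (total degrees, with $\deg 0=-\infty$). *)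

(* Defs.v *)
From mathcomp Require Import all_boot all_order all_algebra.
From mathcomp Require Import complex mpoly constructive_ereal.
(* Only the structure [realType] is imported from [reals]: the notations that
   [reals] brings along clash with those of [mpoly]. *)
From mathcomp Require reals.
Export reals.Real.Exports.

Set Implicit Arguments.
Unset Strict Implicit.
Unset Printing Implicit Defensive.

Import GRing.Theory.
Local Open Scope ring_scope.

(* Total degree, with deg 0 = -oo. *)
Definition mpdeg (K : nzRingType) (n : nat) (p : {mpoly K[n]}) : \bar int :=
  if p == 0 then -oo%E else ((msize p).-1%:Z)%:E.

(* A hypersurface is given by a nonconstant polynomial, hence 0 < k.  If nonzero
   constants were allowed, [sufficiently_intersect] below would hold trivially
   when s < n: an auxiliary polynomial of degree 0 gives 0 = k_1 ... k_n common zeros. *)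
Definition hypersurface_of_degree (K : nzRingType) (n : nat)
    (f : {mpoly K[n]}) (k : nat) : Prop :=
  (0 < k)%N /\ mpdeg f = (k%:Z)%:E.

Definition without_multiple_factors (K : nzRingType) (n : nat)
    (f : {mpoly K[n]}) : Prop :=
  forall g q : {mpoly K[n]}, f = g ^+ 2 * q -> (mpdeg g <= 0)%E.

Definition common_zeros (K : comNzRingType) (n s : nat)
    (f : 'I_s -> {mpoly K[n]}) : {pred 'rV[K]_n} :=
  [pred x : 'rV[K]_n | [forall i, (f i).@[x ord0] == 0]].

Definition sufficiently_intersect (K : comNzRingType) (n s : nat)
    (k : 'I_s -> nat) (f : 'I_s -> {mpoly K[n]}) : Prop :=
  exists (l : 'I_(n - s) -> nat) (g : 'I_(n - s) -> {mpoly K[n]}),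
    (forall j, hypersurface_of_degree (g j) (l j)) /\
    exists pts : seq 'rV[K]_n,
      [/\ uniq pts,
          size pts = (\prod_(i < s) k i * \prod_(j < n - s) l j)%N &
          pts =i [predI common_zeros f & common_zeros g]].

Definition in_ideal_of (K : comNzRingType) (n s : nat)
    (g : 'I_s -> {mpoly K[n]}) (p : {mpoly K[n]}) : Prop :=
  exists h : 'I_s -> {mpoly K[n]}, p = \sum_(i < s) h i * g i.

Definition is_Hbase (K : comNzRingType) (n s : nat)
    (g : 'I_s -> {mpoly K[n]}) : Prop :=
  (forall i, g i != 0) /\
  forall p : {mpoly K[n]}, in_ideal_of g p ->
    exists h : 'I_s -> {mpoly K[n]},
      p = \sum_(i < s) h i * g i /\
      forall i, (mpdeg (h i) + mpdeg (g i) <= mpdeg p)%E.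

(* Main.v *)
From HB Require Import structures.
Require Import Defs.
From mathcomp Require Import all_boot all_order all_algebra.
From mathcomp Require Import complex mpoly constructive_ereal.
From mathcomp Require Import ssrcomplements ring zify.
From mathcomp Require boolp classical_sets cardinality lebesgue_measure.

(** Let F_1, ..., F_n be the leading forms of the given polynomials
    f_1, ..., f_s followed by those of the auxiliary f_(s+1), ..., f_n.

    If p = sum_i h_i f_i with some summand of degree larger than deg p, the
    leading forms of the h_i satisfy a linear relation between F_1, ..., F_s.
    When F_1, ..., F_s is a regular sequence, every such relation is a
    consequence of the trivial ones F_j F_i - F_i F_j = 0, and subtracting the
    same combination of the trivial relations f_j f_i - f_i f_j = 0 from the
    h_i lowers the degree without changing p ([lower_degree]).  So the point
    is that F_1, ..., F_s is regular.

    The forms F_1, ..., F_n have no common zero but the origin.  This is the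
    equality case of the theorem of Bezout: the k_1 ... k_n points at finite
    distance leave nothing for infinity ([no_zero_at_infinity]).  For a zero
    v <> 0 of the leading forms, choose linear forms y_i, i <> r, that vanish at
    v and deform the system into f_i + t y_i^(k_i) (i <> r), f_r + t.  Modulo
    the deformed system, and over K(t), the polynomials of degree at most E
    are spanned by at most k_1 ... k_n monomials; and since v remains a zero at
    infinity for all t, those of degree less than E span a proper subspace.  Hence
    polynomials g_z that separate the k_1 ... k_n points satisfy a nontrivial
    relation sum_z c_z(t) g_z = 0 modulo the deformed system.  As t is not a
    zero divisor modulo that system, one may divide the c_z by the powers of t
    that they have in common; setting t = 0 and evaluating at the points z
    then shows c_z(0) = 0 for all z, which is absurd.

    Both the regularity of the leading forms and that of t come from one
    fact: in a polynomial ring in m variables, if m elements a_1, ..., a_m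
    have finitely many common zeros then a_m is not a zero divisor modulo
    a_1, ..., a_(m-1).  By the Nullstellensatz the ideal (a_1, ..., a_m)
    contains a nonzero polynomial q_i(x_i) in each single variable
    ([univ_mem_of_finite_zeros]); the q_i(x_i) form a regular sequence
    ([regular_univ_seq]); and an ideal with m generators that contains a
    regular sequence of length m has an acyclic Koszul complex
    ([koszul_acyclic_mod], [koszul_last_regular]).  For the first s < n leading
    forms one applies this to F_1, ..., F_s and high powers of the other
    F_j, which do not contribute in low degrees
    ([finite_zeros_graded_regular]).

    The Nullstellensatz is proved for uncountable fields, where a count of
    dimensions replaces elimination theory. *)

Set Implicit Arguments.
Unset Strict Implicit.
Unset Printing Implicit Defensive.

Import GRing.Theory.
Local Open Scope ring_scope.

(** * Ideals generated by finitely many elements *)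

Definition fg_ideal (A : comNzRingType) (a : nat -> A) (m : nat) (u : A) : Prop :=
  exists g : nat -> A, u = \sum_(i < m) g i * a i.

Section FgIdeal.
Variables (A : comNzRingType) (a : nat -> A).

Lemma fg_ideal0 m : fg_ideal a m 0.
Proof. by exists (fun=> 0); rewrite big1 // => i _; rewrite mul0r. Qed.

Lemma fg_idealD m u v : fg_ideal a m u -> fg_ideal a m v -> fg_ideal a m (u + v).
Proof.
move=> [g ->] [h ->]; exists (fun i => g i + h i).
by rewrite -big_split; apply: eq_bigr => i _; rewrite mulrDl.
Qed.

Lemma fg_idealM m r u : fg_ideal a m u -> fg_ideal a m (r * u).
Proof.
move=> [g ->]; exists (fun i => r * g i).
by rewrite big_distrr; apply: eq_bigr => i _; rewrite /= mulrA.
Qed.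

Lemma fg_idealN m u : fg_ideal a m u -> fg_ideal a m (- u).
Proof. by move=> /(fg_idealM (-1)); rewrite mulN1r. Qed.

Lemma fg_idealB m u v : fg_ideal a m u -> fg_ideal a m v -> fg_ideal a m (u - v).
Proof. by move=> Iu /fg_idealN; apply: fg_idealD. Qed.

Lemma fg_ideal_sum m (T : Type) (r : seq T) (P : pred T) (F : T -> A) :
  (forall i, P i -> fg_ideal a m (F i)) -> fg_ideal a m (\sum_(i <- r | P i) F i).
Proof.
by move=> IF; elim/big_ind: _ => //; [apply: fg_ideal0 | apply: fg_idealD].
Qed.

Lemma mem_fg_ideal m i : (i < m)%N -> fg_ideal a m (a i).
Proof.
move=> im; exists (fun j => (j == i)%:R).
rewrite (bigD1 (Ordinal im)) //= eqxx mul1r big1 ?addr0 // => j.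
by rewrite -val_eqE /= => /negPf ->; rewrite mul0r.
Qed.

Lemma fg_idealSP m u :
  fg_ideal a m.+1 u <-> exists w, fg_ideal a m (u - a m * w).
Proof.
split=> [[g ->]|[w [g Eg]]].
  by exists (g m); exists g; rewrite big_ord_recr /= (mulrC (a m)) addrK.
exists (fun i => if i == m then w else g i); rewrite big_ord_recr /= eqxx.
rewrite -[LHS](subrK (a m * w)) Eg (mulrC (a m)); congr (_ + _).
by apply: eq_bigr => i _; rewrite ltn_eqF.
Qed.

End FgIdeal.

Lemma sub_fg_ideal (A : comNzRingType) (a b : nat -> A) m p u :
  (forall i, (i < m)%N -> fg_ideal b p (a i)) -> fg_ideal a m u -> fg_ideal b p u.
Proof.
move=> sub [g ->]; apply: fg_ideal_sum => i _.
by apply: fg_idealM; apply: sub.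
Qed.

Lemma rmorph_fg_ideal (A B : comNzRingType) (phi : {rmorphism A -> B}) (a : nat -> A) m u :
  fg_ideal a m u -> fg_ideal (phi \o a) m (phi u).
Proof.
move=> [g ->]; exists (phi \o g); rewrite rmorph_sum.
by apply: eq_bigr => i _; rewrite rmorphM.
Qed.

Definition regular_seq (A : comNzRingType) (y : nat -> A) (m : nat) : Prop :=
  forall j u, (j < m)%N -> fg_ideal y j (y j * u) -> fg_ideal y j u.

(** * The Koszul complex *)

Section Koszul.
Variables (A : comNzRingType).

(** The complex of a_0, ..., a_m is the mapping cone of multiplication by a_m on
    that of a_0, ..., a_(m-1): the pair (c, c') stands for c + e_m /\ c', with e_m
    the m-th basis vector of the exterior algebra. *)
Fixpoint koszul (m : nat) : lmodType A :=
  if m is m'.+1 then (koszul m' * koszul m')%type : lmodType A else A^o.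

(** The Koszul differential, contraction with a. *)
Fixpoint kd (a : nat -> A) (m : nat) : koszul m -> koszul m :=
  if m is m'.+1 then fun c => (kd a c.1 + a m' *: c.2, - kd a c.2) else fun=> 0.

(** Exterior multiplication by the vector sum_i r_i e_i. *)
Fixpoint kext (r : nat -> A) (m : nat) : koszul m -> koszul m :=
  if m is m'.+1 then fun c => (kext r c.1, r m' *: c.1 - kext r c.2) else fun=> 0.

Lemma kdD a m (c d : koszul m) : kd a (c + d) = kd a c + kd a d.
Proof.
elim: m c d => [|m IH] c d /=; first by rewrite addr0.
by rewrite !IH scalerDr opprD addrACA.
Qed.

Lemma kdZ a m x (c : koszul m) : kd a (x *: c) = x *: kd a c.
Proof.
elim: m c => [|m IH] c /=; first by rewrite scaler0.
by rewrite !IH -[RHS]/(_, _) /= scalerDr scalerN !scalerA mulrC.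
Qed.

Lemma kextZ r m x (c : koszul m) : kext r (x *: c) = x *: kext r c.
Proof.
elim: m c => [|m IH] c /=; first by rewrite scaler0.
by rewrite !IH -[RHS]/(_, _) /= scalerBr !scalerA mulrC.
Qed.

Lemma kextD r m (c d : koszul m) : kext r (c + d) = kext r c + kext r d.
Proof.
elim: m c d => [|m IH] c d /=; first by rewrite addr0.
by rewrite !IH scalerDr opprD addrACA.
Qed.

Lemma kdN a m (c : koszul m) : kd a (- c) = - kd a c.
Proof. by rewrite -scaleN1r kdZ scaleN1r. Qed.

Lemma kextN a m (c : koszul m) : kext a (- c) = - kext a c.
Proof. by rewrite -scaleN1r kextZ scaleN1r. Qed.

Lemma kdK a m (c : koszul m) : kd a (kd a c) = 0.
Proof.
elim: m c => [//|m IH] [u v] /=.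
rewrite kdN kdD kdZ !IH -[RHS]/(0 : koszul m, 0 : koszul m) /= scalerN.
by rewrite add0r subrr !oppr0.
Qed.

(** So every element of the ideal (a_0, ..., a_(m-1)) acts on the complex by a
    map homotopic to zero. *)
Lemma kd_kext a r m (c : koszul m) :
  kd a (kext r c) + kext r (kd a c) = (\sum_(i < m) r i * a i) *: c.
Proof.
elim: m c => [|m IH] c; first by rewrite big_ord0 scale0r addr0.
case: c => u v /=.
rewrite big_ord_recr /=; set s := \sum_(i < m) _ in IH *.
have -> : (s + r m * a m) *: ((u, v) : koszul m.+1) =
   ((s + r m * a m) *: u, (s + r m * a m) *: v) by [].
rewrite !scalerDl -!IH -[LHS]/(_, _) /= kdD kextD !(kdN, kextN, kdZ, kextZ).
rewrite !scalerDr !scalerA (mulrC (a m)) !scalerN.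
rewrite opprK; congr (_, _).
  by rewrite addrACA subrK.
by rewrite opprB !addrA subrK addrAC.
Qed.

(** Coefficientwise membership: the submodule I K of the complex K. *)
Fixpoint kmem (I : A -> Prop) (m : nat) : koszul m -> Prop :=
  if m is m'.+1 then fun c => kmem I c.1 /\ kmem I c.2 else I.

(** Elements of exterior degree i. *)
Fixpoint khom (m i : nat) : koszul m -> Prop :=
  if m is m'.+1 then fun c =>
    khom i c.1 /\ (if i is i'.+1 then khom i' c.2 else c.2 = 0)
  else fun c => (0 < i)%N -> c = 0.

Lemma khom_gt m i (c : koszul m) : (m < i)%N -> khom i c -> c = 0.
Proof.
elim: m i c => [|m IH] [|i] //= c; first by move=> _; apply.
rewrite ltnS => mi [h1 h2]; rewrite [c]surjective_pairing.
by rewrite (IH _ _ (ltnW _) h1) // (IH _ _ mi h2).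
Qed.

Lemma khom0 m i : khom i (0 : koszul m).
Proof. by elim: m i => [|m IH] [|i] //=; split=> //; apply: IH. Qed.

Lemma khomD m i (c d : koszul m) : khom i c -> khom i d -> khom i (c + d).
Proof.
elim: m i c d => [|m IH] i c d /=; first by move=> h1 h2 i0; rewrite h1 ?h2 ?addr0.
move=> [c1 c2] [d1 d2]; split; first exact: IH.
by case: i c1 c2 d1 d2 => [|i] _ c2 _ d2; [rewrite c2 d2 addr0 | apply: IH].
Qed.

Lemma khomZ m i x (c : koszul m) : khom i c -> khom i (x *: c).
Proof.
elim: m i c => [|m IH] i c /=; first by move=> h1 i0; rewrite h1 ?scaler0.
move=> [c1 c2]; split; first exact: IH.
by case: i c1 c2 => [|i] _ c2; [rewrite c2 scaler0 | apply: IH].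
Qed.

Lemma khom_kext r m i (c : koszul m) : khom i c -> khom i.+1 (kext r c).
Proof.
elim: m i c => [//|m IH] i c /= [c1 c2]; split; first exact: IH.
apply: khomD; first exact: khomZ.
rewrite -scaleN1r; apply: khomZ.
by case: i c1 c2 => [|i] _ c2; [rewrite c2 -(scale0r 0) kextZ scale0r; apply: khom0 | apply: IH].
Qed.

Lemma kmem_sub (I J : A -> Prop) m (c : koszul m) :
  (forall u, I u -> J u) -> kmem I c -> kmem J c.
Proof. by move=> sub; elim: m c => //= m IH c [/IH ? /IH ?]. Qed.

Lemma kmem_scale (I : A -> Prop) m x (c : koszul m) :
  (forall u, I (x * u)) -> kmem I (x *: c).
Proof. by move=> Ix; elim: m c => [|m IH] c /=; [apply: Ix | split; apply: IH]. Qed.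

Section Membership.
Variable I : A -> Prop.
Hypotheses (I0 : I 0) (ID : forall u v, I u -> I v -> I (u + v)).
Hypothesis IM : forall r u, I u -> I (r * u).

Lemma kmem0 m : kmem I (0 : koszul m).
Proof. by elim: m => [|m IH]. Qed.

Lemma kmemD m (c d : koszul m) : kmem I c -> kmem I d -> kmem I (c + d).
Proof. by elim: m c d => [|m IH] c d /=; [apply: ID | move=> [? ?] [? ?]; split; apply: IH]. Qed.

Lemma kmemZ m x (c : koszul m) : kmem I c -> kmem I (x *: c).
Proof. by elim: m c => [|m IH] c /=; [apply: IM | move=> [? ?]; split; apply: IH]. Qed.

Lemma kmemN m (c : koszul m) : kmem I c -> kmem I (- c).
Proof. by rewrite -scaleN1r; apply: kmemZ. Qed.

Lemma kmem_kd a m (c : koszul m) : kmem I c -> kmem I (kd a c).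
Proof.
elim: m c => [|m IH] c /=; first by move=> _; exact: I0.
by move=> [? ?]; split; [apply: kmemD; [apply: IH | apply: kmemZ] | apply/kmemN/IH].
Qed.

Lemma kmem_kext r m (c : koszul m) : kmem I c -> kmem I (kext r c).
Proof.
elim: m c => [|m IH] c /=; first by move=> _; exact: I0.
by move=> [? ?]; split; [apply: IH | apply: kmemD; [apply: kmemZ | apply/kmemN/IH]].
Qed.

End Membership.

Lemma kmem_fg_idealS y j m (c : koszul m) :
  kmem (fg_ideal y j.+1) c -> exists w, kmem (fg_ideal y j) (c - y j *: w).
Proof.
elim: m c => [|m IH] c /=; first by move=> /fg_idealSP.
by move=> [/IH[w1 h1] /IH[w2 h2]]; exists (w1, w2).
Qed.

Lemma kmem_regular y j m (c : koszul m) :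
    (forall u, fg_ideal y j (y j * u) -> fg_ideal y j u) ->
  kmem (fg_ideal y j) (y j *: c) -> kmem (fg_ideal y j) c.
Proof.
move=> reg; elim: m c => [|m IH] c /=; first exact: reg.
by move=> [/IH ? /IH ?].
Qed.

(** If (a_0, ..., a_(m-1)) contains a regular sequence y_0, ..., y_(m-1), the
    complex of a over A / (y_0, ..., y_(j-1)) is acyclic in degrees i > j.  This
    holds for j = m since the degrees larger than m are zero.  A cycle c of
    degree i > j modulo (y_0, ..., y_(j-1)) satisfies y_j c = d (r /\ c) for
    y_j = sum_l r_l a_l, so r /\ c is a cycle of degree i + 1 modulo one more
    y; it is then d b + y_j w up to (y_0, ..., y_(j-1)), so that
    y_j c = y_j d w, and y_j can be cancelled. *)
Lemma koszul_acyclic_mod (a y : nat -> A) (m j : nat) (c : koszul m) (i : nat) :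
    regular_seq y m -> (forall l, (l < m)%N -> fg_ideal a m (y l)) ->
    (j <= m)%N -> (j < i)%N -> khom i c -> kmem (fg_ideal y j) (kd a c) ->
  exists w, kmem (fg_ideal y j) (c - kd a w).
Proof.
move=> reg sub; have [p Ep] := ubnP (m - j); elim: p => // p IH in j i c Ep *.
rewrite leq_eqVlt => /predU1P[->|jm] ji ci dc.
  exists 0; rewrite (khom_gt ji ci) -(scale0r 0) kdZ !scale0r subr0.
  exact/kmem0/fg_ideal0.
have [r Er] := sub j jm.
have I0 := fg_ideal0 y j; have ID := @fg_idealD _ y j; have IM := @fg_idealM _ y j.
have hom : y j *: c = kd a (kext r c) + kext r (kd a c) by rewrite kd_kext Er.
have sdc : kmem (fg_ideal y j) (kext r (kd a c)) by apply: kmem_kext.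
have dsc : kmem (fg_ideal y j.+1) (kd a (kext r c)).
  have -> : kd a (kext r c) = y j *: c - kext r (kd a c) by rewrite hom addrK.
  apply: kmemD; first exact: fg_idealD.
    by apply: kmem_scale => x; rewrite mulrC; apply/fg_idealM/mem_fg_ideal.
  apply: kmemN; first exact: fg_idealM.
  apply: kmem_sub sdc => u; apply: sub_fg_ideal => l lj.
  by apply: mem_fg_ideal; apply: leq_trans lj _.
have [||b] := IH j.+1 i.+1 _ _ jm _ (khom_kext r ci) dsc; [lia|lia|].
case/kmem_fg_idealS=> w hw; exists w; apply: kmem_regular (fun u => reg j u jm) _.
have -> : y j *: (c - kd a w) =
   kd a (kext r c - kd a b - y j *: w) + kext r (kd a c).
  rewrite !kdD !kdN kdK subr0 kdZ scalerBr hom.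
  by rewrite -!addrA; congr (_ + _); rewrite addrC.
by apply: kmemD => //; apply: kmem_kd.
Qed.

(** The inclusions of exterior degrees 0 and 1, and the projection to degree 0. *)
Fixpoint kscalar (m : nat) (x : A) : koszul m :=
  if m is m'.+1 then (kscalar m' x, 0) else x.

Fixpoint kvector (m : nat) (h : nat -> A) : koszul m :=
  if m is m'.+1 then (kvector m' h, kscalar m' (h m')) else 0.

Fixpoint kscal (m : nat) : koszul m -> A :=
  if m is m'.+1 then fun c => kscal c.1 else id.

Lemma kscalarK m x : kscal (kscalar m x) = x.
Proof. by elim: m. Qed.

Lemma kscalD m (c d : koszul m) : kscal (c + d) = kscal c + kscal d.
Proof. by elim: m c d => //= m IH c d; rewrite IH. Qed.

Lemma kscalZ m x (c : koszul m) : kscal (x *: c) = x * kscal c.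
Proof. by elim: m c => //= m IH c; rewrite IH. Qed.

Lemma kscalarD m x y : kscalar m (x + y) = kscalar m x + kscalar m y.
Proof. by elim: m => //= m ->; rewrite -[RHS]/(_, _) /= addr0. Qed.

Lemma kscalarZ m x y : kscalar m (x * y) = x *: kscalar m y.
Proof. by elim: m => //= m ->; rewrite -[RHS]/(_, _) /= scaler0. Qed.

Lemma kscalar0 m : kscalar m 0 = 0.
Proof. by elim: m => //= m ->. Qed.

Lemma kd_kscalar a m x : kd a (kscalar m x) = 0.
Proof.
elim: m => //= m ->; rewrite scaler0 addr0.
by rewrite -(scale0r (0 : koszul m)) kdZ !scale0r oppr0.
Qed.

Lemma kd_kvector a m h : kd a (kvector m h) = kscalar m (\sum_(i < m) h i * a i).
Proof.
elim: m => /= [|m IH]; first by rewrite big_ord0.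
by rewrite IH kd_kscalar oppr0 big_ord_recr kscalarD mulrC kscalarZ.
Qed.

Lemma khom_kscalar m x : khom 0 (kscalar m x).
Proof. by elim: m. Qed.

Lemma khom_kvector m h : khom 1 (kvector m h).
Proof. by elim: m => //= m IH; split=> //; apply: khom_kscalar. Qed.

Lemma fg_ideal_kscal_kd a m (c : koszul m) : fg_ideal a m (kscal (kd a c)).
Proof.
elim: m c => [|m IH] c /=; first exact: fg_ideal0.
rewrite kscalD kscalZ; apply: fg_idealD; last by rewrite mulrC; apply/fg_idealM/mem_fg_ideal.
by apply: sub_fg_ideal (IH _) => i im; apply/mem_fg_ideal/leqW.
Qed.

(** A relation sum_l h_l a_l = 0 is a 1-cycle, hence a boundary, and the last
    coefficient of a boundary lies in the ideal of the other a_l. *)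
Lemma koszul_last_regular (a y : nat -> A) (m : nat) (u : A) :
    regular_seq y m.+1 -> (forall l, (l < m.+1)%N -> fg_ideal a m.+1 (y l)) ->
  fg_ideal a m (a m * u) -> fg_ideal a m u.
Proof.
move=> reg sub [g Eg].
pose h i := if i == m then u else - g i.
have [//|//|||w] := koszul_acyclic_mod (j := 0) (c := kvector m.+1 h) (i := 1) reg sub.
- exact: khom_kvector.
- rewrite kd_kvector big_ord_recr /= {2}/h eqxx (mulrC u) Eg -big_split big1.
    by rewrite kscalar0; split; apply/kmem0/fg_ideal0.
  by move=> i _; rewrite /= /h ltn_eqF // mulNr addNr.
case=> _; rewrite /= /h eqxx opprK => hw.
have -> : u = - kscal (kd a w.2).
  have : kscal (kscalar m u + kd a w.2) = 0.
    elim: (m) (_ + _) hw => [|n IHn] d /=; last by case=> /IHn.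
    by case=> k ->; rewrite big_ord0.
  by rewrite kscalD kscalarK => /eqP; rewrite addr_eq0 => /eqP.
exact/fg_idealN/fg_ideal_kscal_kd.
Qed.

End Koszul.

(** * One-variable polynomials in distinct variables *)

Section UnivariateSequence.
Variables (K : fieldType) (n : nat).
Local Notation A := {mpoly K[n]}.

Section Extension.
Variable F : 'X_{1..n} -> A.

(** The linear map with given values on the monomials. *)
Definition mlin (p : A) : A := \sum_(m <- msupp p) p@_m *: F m.

Lemma mlinE k p : (msize p <= k)%N -> mlin p = \sum_(m : 'X_{1..n < k}) p@_m *: F m.
Proof.
move=> pk; rewrite /mlin (big_mksub 'X_{1..n < k}) ?msupp_uniq //=; last first.
  by move=> m /msize_mdeg_lt /leq_trans; apply.
by rewrite big_rmcond //= => m /memN_msupp_eq0 ->; rewrite scale0r.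
Qed.

Lemma mlin_is_linear : linear mlin.
Proof.
move=> c p q; pose k := maxn (maxn (msize p) (msize q)) (msize (c *: p + q)).
rewrite !(@mlinE k) ?leq_max ?leqnn ?orbT //.
rewrite scaler_sumr -big_split; apply: eq_bigr => m _ /=.
by rewrite mcoeffD mcoeffZ scalerDl scalerA.
Qed.

HB.instance Definition _ := GRing.isLinear.Build K A A _ mlin mlin_is_linear.

Lemma mlinX m : mlin 'X_[m] = F m.
Proof. by rewrite /mlin msuppX big_seq1 mcoeffX eqxx scale1r. Qed.

End Extension.

Definition univ (i : 'I_n) (q : {poly K}) : A := horner_alg 'X_i q.

HB.instance Definition _ i := GRing.LRMorphism.copy (univ i) (univ i).

Lemma univXn i k : univ i 'X^k = 'X_[U_(i) *+ k].
Proof. by rewrite /univ rmorphXn /= horner_algX mpolyXn. Qed.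

Lemma univZ i c p : univ i (c *: p) = c *: univ i p.
Proof. by rewrite /univ linearZ /= mulr_algl. Qed.

(** The remainder of the division by q(x_i), with the other variables as
    constants. *)
Definition mrem (i : 'I_n) (q : {poly K}) : A -> A :=
  mlin (fun m => univ i ('X^(m i) %% q) * 'X_[m - U_(i) *+ m i]).

HB.instance Definition _ i q := GRing.Linear.copy (mrem i q) (mrem i q).

Lemma mremX i q m : mrem i q 'X_[m] = univ i ('X^(m i) %% q) * 'X_[m - U_(i) *+ m i].
Proof. exact: mlinX. Qed.

Lemma mrem_prod i q p (m : 'X_{1..n}) :
  m i = 0%N -> mrem i q (univ i p * 'X_[m]) = univ i (p %% q) * 'X_[m].
Proof.
move=> mi0; rewrite -[p]coefK poly_def.
rewrite (big_morph (fun p => p %% q) (modpD q) (mod0p q)) !rmorph_sum /=.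
rewrite !mulr_suml linear_sum /=; apply: eq_bigr => k _.
rewrite modpZl !univZ -!scalerAl linearZ /= univXn -mpolyXD mremX.
rewrite !mnmDE mulmnE mnm1E eqxx mul1n mi0 addn0; congr (_ *: (_ * 'X_[_])).
by rewrite addmC addmK.
Qed.

Lemma univ_mrem_decomp i (m : 'X_{1..n}) :
  'X_[m] = univ i 'X^(m i) * 'X_[m - U_(i) *+ m i] :> A.
Proof.
rewrite univXn -mpolyXD addmC submK //; apply/mnm_lepP => j.
by rewrite mulmnE mnm1E; case: eqP => [->|_]; rewrite ?mul1n ?mul0n.
Qed.

Lemma mrem_exponent i (m : 'X_{1..n}) : (m - U_(i) *+ m i)%MM i = 0%N.
Proof. by rewrite mnmBE mulmnE mnm1E eqxx mul1n subnn. Qed.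

Lemma mrem_mull i q u : mrem i q (univ i q * u) = 0.
Proof.
rewrite [u]mpolyE mulr_sumr linear_sum big1 // => m _ /=.
rewrite -scalerAr linearZ /= (univ_mrem_decomp i m) mulrA -rmorphM /=.
by rewrite mrem_prod ?mrem_exponent // modp_mulr rmorph0 mul0r scaler0.
Qed.

Lemma mrem_mulC i j q p u : j != i -> mrem i q (univ j p * u) = univ j p * mrem i q u.
Proof.
move=> ji; rewrite [u]mpolyE mulr_sumr !linear_sum mulr_sumr.
apply: eq_bigr => m _ /=; rewrite -scalerAr !linearZ -scalerAr /=; congr (_ *: _).
rewrite -[p]coefK poly_def rmorph_sum /= !mulr_suml linear_sum /=.
apply: eq_bigr => k _; rewrite !univZ -!scalerAl linearZ /=; congr (_ *: _).
rewrite univXn mulrC {1}(univ_mrem_decomp i m) -mulrA -mpolyXD mrem_prod; last first.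
  by rewrite mnmDE mrem_exponent mulmnE mnm1E (negPf ji) mul0n.
by rewrite mremX mpolyXD mulrA mulrC.
Qed.

Lemma mrem_congr i q u : exists w, u - mrem i q u = univ i q * w.
Proof.
have [w Ew] : exists w : 'X_{1..n} -> A, forall m,
    'X_[m] - mrem i q 'X_[m] = univ i q * w m.
  exists (fun m : 'X_{1..n} => univ i ('X^(m i) %/ q) * 'X_[m - U_(i) *+ m i]) => m.
  rewrite mremX [X in X - _](univ_mrem_decomp i m) -mulrBl mulrA -rmorphB -rmorphM /=.
  by congr (univ i _ * _); rewrite {1}(divp_eq 'X^(m i) q) addrK mulrC.
exists (mlin w u); rewrite /mlin mulr_sumr.
under [RHS]eq_bigr do rewrite -scalerAr -Ew scalerBr.
rewrite sumrB -mpolyE; congr (_ - _); rewrite {1}[u]mpolyE linear_sum.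
by apply: eq_bigr => m _; rewrite linearZ.
Qed.

Lemma mcoeff_univ i q k : (univ i q)@_(U_(i) *+ k) = q`_k.
Proof.
rewrite -[q in LHS]coefK poly_def rmorph_sum raddf_sum /=.
have [kq|qk] := ltnP k (size q); last rewrite nth_default //.
  rewrite (bigD1 (Ordinal kq)) //= univZ mcoeffZ univXn mcoeffX eqxx mulr1.
  rewrite big1 ?addr0 // => l lk; rewrite univZ mcoeffZ univXn mcoeffX.
  case: eqP => [E|]; rewrite ?mulr0 //; case/eqP: lk; apply: val_inj => /=.
  by have /mnmP/(_ i) := E; rewrite !mulmnE mnm1E eqxx !mul1n.
rewrite big1 // => l _; rewrite univZ mcoeffZ univXn mcoeffX.
case: eqP => [E|]; rewrite ?mulr0 //.
have /mnmP/(_ i) := E; rewrite !mulmnE mnm1E eqxx !mul1n => lk.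
by have := ltn_ord l; rewrite lk ltnNge qk.
Qed.

Lemma univ_eq0 i q : (univ i q == 0) = (q == 0).
Proof.
apply/eqP/eqP => [uq0|->]; last exact: rmorph0.
by apply/polyP => k; rewrite -(mcoeff_univ i) uq0 mcoeff0 coef0.
Qed.

Variable q : 'I_n -> {poly K}.

Definition univ_seq (j : nat) : A := oapp (fun i => univ i (q i)) 0 (insub j).

Fixpoint mrems (j : nat) (u : A) : A :=
  if j is j'.+1 then oapp (fun i => mrem i (q i) (mrems j' u)) (mrems j' u) (insub j')
  else u.

Lemma univ_seqE (i : 'I_n) : univ_seq i = univ i (q i).
Proof. by rewrite /univ_seq valK. Qed.

Lemma mrems_is_linear j : linear (mrems j).
Proof.
move=> c u v; elim: j => //= j ->.
by case: insub => //= i; rewrite linearP.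
Qed.

HB.instance Definition _ j := GRing.isLinear.Build K A A _ (mrems j) (mrems_is_linear j).

Lemma mrems_mulC j (i : 'I_n) u :
  (j <= i)%N -> mrems j (univ_seq i * u) = univ_seq i * mrems j u.
Proof.
elim: j => //= j IH ji; rewrite IH ?(ltnW ji) //.
case: insubP => //= l _ lj; rewrite !univ_seqE mrem_mulC //.
by rewrite -val_eqE /= lj gtn_eqF.
Qed.

Lemma mrems_mull j (i : 'I_n) u : (i < j)%N -> mrems j (univ_seq i * u) = 0.
Proof.
elim: j => //= j IH; rewrite ltnS leq_eqVlt => /predU1P[<-|ij].
  by rewrite valK /= mrems_mulC // univ_seqE mrem_mull.
by rewrite IH //; case: insub => //= l; rewrite linear0.
Qed.

Lemma mrems_congr j u : fg_ideal univ_seq j (u - mrems j u).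
Proof.
elim: j => /= [|j IH]; first by rewrite subrr; apply: fg_ideal0.
have {}IH : fg_ideal univ_seq j.+1 (u - mrems j u).
  by apply: sub_fg_ideal IH => i ij; apply/mem_fg_ideal/leqW.
case: insubP => //= i _ ij; rewrite -(subrKA (mrems j u)); apply: fg_idealD => //.
have [w ->] := mrem_congr i (q i) (mrems j u).
by rewrite mulrC; apply: fg_idealM; rewrite -univ_seqE ij; apply: mem_fg_ideal.
Qed.

(** The remainder in one variable commutes with multiplication by
    polynomials in another one ([mrem_mulC]).  So the composite of the
    remainders modulo the first j polynomials is a normal form modulo their
    ideal, and it commutes with multiplication by the next polynomial. *)
Lemma regular_univ_seq : (forall i, q i != 0) -> regular_seq univ_seq n.
Proof.
move=> q0 j u jn.
have inP v : fg_ideal univ_seq j v <-> mrems j v = 0.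
  split=> [[g ->]|v0]; last by have := mrems_congr j v; rewrite v0 subr0.
  rewrite linear_sum big1 // => i _ /=; rewrite mulrC.
  exact: (mrems_mull (g i) (i := Ordinal (ltn_trans (ltn_ord i) jn)) (ltn_ord i)).
rewrite !inP; rewrite -[j in univ_seq j]/(val (Ordinal jn)) mrems_mulC //.
by move/eqP; rewrite mulf_eq0 univ_seqE univ_eq0 (negPf (q0 _)) => /eqP.
Qed.

End UnivariateSequence.

(** * Adjoining a parameter *)

Section Deformation.
Variable (A : comNzRingType).

Definition param_seq (y : nat -> A) (j : nat) : {poly A} :=
  if j is j'.+1 then (y j')%:P else 'X.

Lemma poly_at0_decomp (w : {poly A}) : exists v, w = (w.[0])%:P + 'X * v.
Proof.
have : root (w - (w.[0])%:P) 0 by rewrite rootE !hornerE subrr.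
case/factor_theorem => v; rewrite subr0 mulrC => /(canRL (subrK _)) ->.
by exists v; rewrite !hornerE addrC.
Qed.

Lemma fg_ideal_param_seq y j w :
  fg_ideal (param_seq y) j.+1 w <-> fg_ideal y j w.[0].
Proof.
split=> [|wI].
  case=> g ->; exists (fun i => (g i.+1).[0]).
  rewrite horner_sum big_ord_recl /= hornerM hornerX mulr0 add0r.
  by apply: eq_bigr => i _; rewrite hornerM hornerC.
have [v ->] := poly_at0_decomp w; apply: fg_idealD; last first.
  by rewrite mulrC; apply/fg_idealM/(mem_fg_ideal (param_seq y) (i := 0)).
apply: sub_fg_ideal (rmorph_fg_ideal polyC wI) => i ij /=.
exact: (mem_fg_ideal (param_seq y) (i := i.+1)).
Qed.

Lemma regular_param_seq y m : regular_seq y m -> regular_seq (param_seq y) m.+1.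
Proof.
move=> reg [|j] u jm.
  case=> g; rewrite big_ord0 mulrC => /polyP uX0; suff -> : u = 0 by apply: fg_ideal0.
  by apply/polyP => k; have := uX0 k.+1; rewrite coefMX !coef0.
by rewrite !fg_ideal_param_seq /= hornerM hornerC; apply: reg.
Qed.

End Deformation.

(** * The Nullstellensatz over an uncountable algebraically closed field *)

(** Equivalent to the usual notion, since countable sets are the countable unions
    of finite ones. *)
Definition uncountable (T : eqType) : Prop :=
  forall s : nat -> seq T, exists x, forall d, x \notin s d.

Definition ideal (A : comNzRingType) (I : A -> Prop) : Prop :=
  [/\ I 0, forall u v, I u -> I v -> I (u + v) & forall r u, I u -> I (r * u)].

Definition adjoin (A : comNzRingType) (I : A -> Prop) (b u : A) : Prop :=
  exists w, I (u - b * w).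

Lemma ideal_fg_ideal (A : comNzRingType) (a : nat -> A) m : ideal (fg_ideal a m).
Proof.
by split; [apply: fg_ideal0 | apply: fg_idealD | apply: fg_idealM].
Qed.

Section IdealTheory.
Variables (A : comNzRingType) (I : A -> Prop).
Hypothesis idealI : ideal I.

Lemma ideal0 : I 0. Proof. by case: idealI. Qed.

Lemma idealD u v : I u -> I v -> I (u + v).
Proof. by case: idealI => _ + _; apply. Qed.

Lemma idealM r u : I u -> I (r * u).
Proof. by case: idealI => _ _; apply. Qed.

Lemma idealMr r u : I u -> I (u * r).
Proof. by rewrite mulrC; apply: idealM. Qed.

Lemma idealB u v : I u -> I v -> I (u - v).
Proof. by move=> Iu /(idealM (-1)); rewrite mulN1r; apply: idealD. Qed.

Lemma ideal_sum (T : Type) (r : seq T) (P : pred T) (F : T -> A) :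
  (forall i, P i -> I (F i)) -> I (\sum_(i <- r | P i) F i).
Proof. by move=> IF; elim/big_ind: _ => //; [apply: ideal0 | apply: idealD]. Qed.

Lemma ideal_adjoin b : ideal (adjoin I b).
Proof.
split=> [|u v [x Ix] [y Iy]|r u [x Ix]]; first by exists 0; rewrite mulr0 subr0; apply: ideal0.
  by exists (x + y); rewrite mulrDr opprD addrACA; apply: idealD.
by exists (r * x); rewrite mulrCA -mulrBr; apply: idealM.
Qed.

Lemma sub_adjoin b u : I u -> adjoin I b u.
Proof. by exists 0; rewrite mulr0 subr0. Qed.

Lemma mem_adjoin b : adjoin I b b.
Proof. by exists 1; rewrite mulr1 subrr; apply: ideal0. Qed.

End IdealTheory.

Lemma uniq_seq_or_cover (T : eqType) (P : T -> Prop) N :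
  (exists s, [/\ uniq s, size s = N & forall x, x \in s -> P x]) \/
  (exists t : seq T, forall x, P x -> x \in t).
Proof.
elim: N => [|N [[s [us sN Ps]]|]]; [by left; exists [::] | | by right].
case: (boolp.pselect (exists2 x, P x & x \notin s)) => [[x Px xs]|no].
  left; exists (x :: s); split=> /=; rewrite ?xs ?sN //.
  by move=> y; rewrite inE => /predU1P[->|/Ps].
right; exists s => x Px; apply: contraT => xs; case: no; by exists x.
Qed.

(** The parameter d takes countably many values, so one of the sets P d is
    infinite. *)
Lemma uncountable_pigeonhole (T : eqType) (P : nat -> T -> Prop)
    (N : nat -> nat) (bad : seq T) :
    uncountable T -> (forall a, a \notin bad -> exists d, P d a) ->
  exists d s, [/\ uniq s, size s = N d & forall x, x \in s -> P d x].
Proof.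
move=> uncT PT; apply: boolp.contrapT => no.
have /boolp.choice[t Et] d : exists t : seq T, forall x, P d x -> x \in t.
  by case: (uniq_seq_or_cover (P d) (N d)) => // -[s hs]; case: no; exists d, s.
have [x hx] := uncT (fun d => bad ++ t d).
have [|d /Et xd] := PT x; first by have := hx 0%N; rewrite mem_cat => /norP[].
by have := hx d; rewrite mem_cat xd orbT.
Qed.

Section Nullstellensatz.
Variables (K : closedFieldType) (n : nat).
Hypothesis uncK : uncountable K.
Local Notation A := {mpoly K[n]}.

Lemma mpoly_dependent (d : nat) (h : 'I_(#|{: 'X_{1..n < d}}|.+1) -> A) :
    (forall j, (msize (h j) <= d)%N) ->
  exists2 c : 'I_(#|{: 'X_{1..n < d}}|.+1) -> K,
    exists j, c j != 0 & \sum_j c j *: h j = 0.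
Proof.
set D := #|_| in h *; move=> hd.
pose M : 'M[K]_(D.+1, D) := \matrix_(j, k) (h j)@_(enum_val k : 'X_{1..n < d}).
have : kermx M != 0.
  by rewrite -mxrank_eq0 mxrank_ker subn_eq0 -ltnNge ltnS rank_leq_col.
case/rowV0Pn => v /sub_kermxP vM v0; exists (fun j => v ord0 j).
  by have /rV0Pn[j vj] := v0; exists j.
apply/mpolyP => m; rewrite mcoeff0 raddf_sum /=.
have [md|dm] := ltnP (mdeg m) d; last first.
  rewrite big1 // => j _; rewrite mcoeffZ memN_msupp_eq0 ?mulr0 //.
  by apply: msize_mdeg_ge; apply: leq_trans dm.
have /matrixP/(_ ord0 (enum_rank (BMultinom md))) := vM; rewrite !mxE => vM0.
by rewrite -[RHS]vM0; apply: eq_bigr => j _; rewrite mcoeffZ !mxE enum_rankK.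
Qed.

Lemma univ_XsubC (i : 'I_n) (a : K) : univ i ('X - a%:P) = 'X_i - a%:MP.
Proof. by rewrite /univ rmorphB /= horner_algX horner_algC alg_mpolyC. Qed.

(** Let h_a be an inverse of x_i - a modulo I.  There are uncountably many a, so
    for some d arbitrarily many of the h_a have degree at most d, and these are
    linearly dependent.  Clearing denominators in a relation between the
    h_a = 1 / (x_i - a) gives the polynomial; it is nonzero because the
    rational functions 1 / (T - a) are linearly independent. *)
Lemma univ_mem_of_inverses (I : A -> Prop) (i : 'I_n) (bad : seq K) :
    ideal I -> (forall a, a \notin bad -> adjoin I ('X_i - a%:MP) 1) ->
  exists2 q, q != 0 & I (univ i q).
Proof.
move=> idI inv.
pose P d a := exists2 h : A, I (1 - ('X_i - a%:MP) * h) & (msize h <= d)%N.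
have [|d [s [us ss Ps]]] := uncountable_pigeonhole (P := P)
    (fun d => #|{: 'X_{1..n < d}}|.+1) (bad := bad) uncK.
  by move=> a /inv[h Ih]; exists (msize h), h.
have /boolp.choice[h Eh] a : exists h : A, P d a ->
    I (1 - ('X_i - a%:MP) * h) /\ (msize h <= d)%N.
  by case: (boolp.pselect (P d a)) => [[h]|nP]; [exists h | exists 0].
have sP (j : 'I_(#|{: 'X_{1..n < d}}|.+1)) : s`_j \in s by rewrite mem_nth ?ss.
have [|c [j0 cj0] c0] := mpoly_dependent (d := d) (h := fun j => h s`_j).
  by move=> j; have [] := Eh _ (Ps _ (sP j)).
pose e (j : 'I_(#|{: 'X_{1..n < d}}|.+1)) : {poly K} := \prod_(l | l != j) ('X - (s`_l)%:P).
exists (\sum_j c j *: e j).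
  apply/eqP => /(congr1 (fun p => p.[s`_j0])); rewrite horner0 horner_sum.
  rewrite (bigD1 j0) //= big1 ?addr0 => [|j jj0]; last first.
    rewrite hornerZ horner_prod (bigD1 j0) 1?eq_sym //= !hornerE subrr.
    by rewrite /= mulr0 mul0r.
  move/eqP; rewrite hornerZ mulf_eq0 (negPf cj0) horner_prod /=.
  apply/negP/prodf_neq0 => l lj; rewrite !hornerE subr_eq0 nth_uniq ?ss //.
  by rewrite eq_sym.
pose b := univ i (\prod_(l < #|{: 'X_{1..n < d}}|.+1) ('X - (s`_l)%:P)).
have -> : univ i (\sum_j c j *: e j) =
    \sum_j c j *: (univ i (e j) - b * h s`_j) + b * \sum_j c j *: h s`_j.
  rewrite mulr_sumr -big_split rmorph_sum; apply: eq_bigr => j _ /=.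
  by rewrite univZ scalerBr -scalerAr subrK.
rewrite c0 mulr0 addr0; apply: ideal_sum => // j _.
rewrite -mul_mpolyC; apply: idealM => //.
rewrite /b (bigD1 j) //= rmorphM /= -/(e j) univ_XsubC mulrAC mulrC.
rewrite -{1}[univ i (e j)]mulr1 -mulrBr; apply: idealM => //.
by have [] := Eh _ (Ps _ (sP j)).
Qed.

(** Otherwise all x_i - a are invertible modulo I, and so is the product of
    linear factors that [univ_mem_of_inverses] puts into I. *)
Lemma proper_adjoin_XsubC (I : A -> Prop) (i : 'I_n) :
  ideal I -> ~ I 1 -> exists a, ~ adjoin I ('X_i - a%:MP) 1.
Proof.
move=> idI nI; apply: boolp.contrapT => no.
have inv a : adjoin I ('X_i - a%:MP) 1.
  by apply: boolp.contrapT => na; apply: no; exists a.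
have [q q0] := univ_mem_of_inverses (i := i) (bad := [::]) idI (fun a _ => inv a).
have [r Er] := closed_field_poly_normal q; rewrite Er univZ -mul_mpolyC => Iq.
have {q Er q0}Iq : I (univ i (\prod_(z <- r) ('X - z%:P))).
  rewrite -[X in I X]mul1r -mpolyC1 -(mulVf (_ : lead_coef q != 0)) ?lead_coef_eq0 //.
  by rewrite mpolyCM -mulrA; apply: idealM.
apply: nI; elim: r Iq => [|a r IH]; first by rewrite big_nil rmorph1.
rewrite big_cons rmorphM /= univ_XsubC => Iq; apply: IH.
have [w Iw] := inv a; set e := univ i _ in Iq *.
have -> : e = e * (1 - ('X_i - a%:MP) * w) + w * (('X_i - a%:MP) * e) by ring.
by apply: idealD => //; apply: idealM.
Qed.

Lemma meval_congr (I : A -> Prop) (x : 'I_n -> K) (p : A) :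
  ideal I -> (forall i, I ('X_i - (x i)%:MP)) -> I (p - (p.@[x])%:MP).
Proof.
move=> idI Ix; rewrite {1}[p]mpolyE mevalE raddf_sum -sumrB /=.
apply: ideal_sum => // m _; rewrite mpolyCM -mul_mpolyC -mulrBr; apply: idealM => //.
rewrite mpolyXE_id rmorph_prod /=.
elim/big_rec2: _ => [|i u v _ Iuv]; first by rewrite subrr; apply: ideal0.
have -> : 'X_i ^+ m i * v - (x i ^+ m i)%:MP * u =
   'X_i ^+ m i * (v - u) + u * ('X_i ^+ m i - (x i ^+ m i)%:MP) by ring.
apply: idealD => //; apply: idealM => //.
by rewrite rmorphXn subrXX; apply: idealMr.
Qed.

(** Adjoining x_1 - a_1, ..., x_n - a_n one after the other, with a_i chosen by
    [proper_adjoin_XsubC], enlarges a proper ideal I to the ideal of a point,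
    which is then a zero of I. *)
Theorem nullstellensatz (I : A -> Prop) :
    ideal I -> (forall x : 'I_n -> K, exists2 p, I p & p.@[x] != 0) ->
  I 1.
Proof.
move=> idI noz; apply: boolp.contrapT => nI.
have step k : (k <= n)%N -> exists (x : 'I_n -> K) (J : A -> Prop),
    [/\ ideal J, forall u, I u -> J u, ~ J 1
      & forall i : 'I_n, (i < k)%N -> J ('X_i - (x i)%:MP)].
  elim: k => [_|k IH kn]; first by exists (fun=> 0), I.
  have [x [J [idJ IJ nJ Jx]]] := IH (ltnW kn).
  have [a na] := proper_adjoin_XsubC (Ordinal kn) idJ nJ.
  exists (fun i => if i == Ordinal kn then a else x i), (adjoin J ('X_(Ordinal kn) - a%:MP)).
  split=> // [|u Iu|i]; [exact: ideal_adjoin | exact/sub_adjoin/IJ |].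
  rewrite ltnS leq_eqVlt -[_ == _ :> nat]/(i == Ordinal kn).
  by case: eqP => [-> _|_ /Jx]; [apply: mem_adjoin | apply: sub_adjoin].
have [x [J [idJ IJ nJ Jx]]] := step n (leqnn n).
have [p /IJ Jp px] := noz x; apply: nJ.
have Jc : J (p.@[x])%:MP.
  rewrite -[X in J X](subKr p); apply: idealB => //.
  by apply: meval_congr => // i; apply: Jx.
by rewrite -mpolyC1 -(mulVf px) mpolyCM; apply: idealM.
Qed.

(** If a is not the i-th coordinate of a zero of f, then f and x_i - a have no
    common zero, so x_i - a is invertible modulo f. *)
Lemma univ_mem_of_finite_zeros (f : nat -> A) m (i : 'I_n) (bad : seq K) :
    (forall x : 'I_n -> K, (forall j, (j < m)%N -> (f j).@[x] = 0) -> x i \in bad) ->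
  exists2 q, q != 0 & fg_ideal f m (univ i q).
Proof.
move=> fin; have idf := ideal_fg_ideal f m.
apply: (univ_mem_of_inverses (bad := bad)) => // a abad.
apply: nullstellensatz => [|x]; first exact: ideal_adjoin.
have [xa|xa] := eqVneq (x i) a; last first.
  by exists ('X_i - a%:MP); rewrite ?mevalB ?mevalXU ?mevalC ?subr_eq0 //; apply: mem_adjoin.
apply: boolp.contrapT => no; move/negP: abad; apply; rewrite -xa.
apply: fin => j jm; apply/eqP; apply: contraT => fj; case: no.
by exists (f j) => //; apply/sub_adjoin/mem_fg_ideal.
Qed.

End Nullstellensatz.

(** * Systems with finitely many zeros are regular *)

Definition finite_zeros (K : fieldType) (n : nat) (f : nat -> {mpoly K[n]})
    (m : nat) : Prop :=
  exists bad : seq K, forall x : 'I_n -> K,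
    (forall j, (j < m)%N -> (f j).@[x] = 0) -> forall i, x i \in bad.

Section FiniteZeros.
Variables (K : closedFieldType) (n : nat).
Hypothesis uncK : uncountable K.
Local Notation A := {mpoly K[n]}.

Lemma univ_seq_of_finite_zeros (f : nat -> A) m :
    finite_zeros f m -> exists q : 'I_n -> {poly K},
  (forall i, q i != 0) /\ (forall l, (l < n)%N -> fg_ideal f m (univ_seq q l)).
Proof.
move=> [bad fin].
have /boolp.choice[q Eq] (i : 'I_n) : exists q, q != 0 /\ fg_ideal f m (univ i q).
  have [|q q0 fq] := univ_mem_of_finite_zeros (i := i) (bad := bad) (f := f) (m := m) uncK.
    by move=> x /fin.
  by exists q.
exists q; split=> [i|l ln]; first by have [] := Eq i.
by rewrite -[l]/(val (Ordinal ln)) univ_seqE; have [] := Eq (Ordinal ln).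
Qed.

(** An instance of the Cohen-Macaulay property of polynomial rings: systems of
    parameters are regular sequences. *)
Lemma finite_zeros_last_regular (f : nat -> A) k u :
  n = k.+1 -> finite_zeros f n -> fg_ideal f k (f k * u) -> fg_ideal f k u.
Proof.
move=> nk /univ_seq_of_finite_zeros[q [q0 fq]].
suff key N (y : nat -> A) : N = k.+1 -> regular_seq y N ->
    (forall l, (l < N)%N -> fg_ideal f N (y l)) -> fg_ideal f k (f k * u) -> fg_ideal f k u.
  exact: key nk (regular_univ_seq q0) fq.
by move=> -> reg sub; apply: koszul_last_regular reg sub.
Qed.

(** The n + 1 elements F, t have the same finite set of zeros as the system F at
    t = 0, so t, as the last of them, is not a zero divisor modulo F. *)
Lemma finite_zeros_param_regular (F : nat -> {poly A}) (w : {poly A}) :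
    finite_zeros (fun j => (F j).[0]) n ->
  fg_ideal F n ('X * w) -> fg_ideal F n w.
Proof.
move=> /univ_seq_of_finite_zeros[q [q0 fq]] XwF.
pose a j := if j == n then 'X else F j.
have aF j : (j < n)%N -> a j = F j by rewrite /a => /ltn_eqF ->.
have subF v : fg_ideal F n v <-> fg_ideal a n v.
  by split; apply: sub_fg_ideal => j jn; [rewrite -aF // | rewrite aF //];
     apply: mem_fg_ideal.
have reg := regular_param_seq (regular_univ_seq q0).
rewrite subF; apply: (koszul_last_regular reg); last first.
  by rewrite -subF /a eqxx.
have aX : fg_ideal a n.+1 'X.
  by have := mem_fg_ideal a (ltnSn n); rewrite /a eqxx.
case=> [|l] //=; rewrite ltnS => /fq/(rmorph_fg_ideal polyC).
apply: sub_fg_ideal => j jn /=; have [v Ev] := poly_at0_decomp (F j).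
have -> : ((F j).[0])%:P = F j - v * 'X by rewrite [X in X - _]Ev mulrC addrK.
apply: fg_idealB; last exact: fg_idealM.
by rewrite -aF //; apply/mem_fg_ideal/ltnW.
Qed.

End FiniteZeros.

(** * Homogeneous components *)

Section Grading.
Variables (K : fieldType) (n : nat).
Local Notation A := {mpoly K[n]}.

Fact grade_key : unit. Proof. by []. Qed.

(** The substitution x_i := x_i T: the coefficient of T^d in [grade p] is the
    homogeneous component of degree d of p.  Being a ring morphism, it reduces
    computations with components to coefficients of products.  It is locked to
    keep unification from unfolding it into a sum over monomials. *)
Definition grade : A -> {poly A} :=
  locked_with grade_key (mmap (polyC \o @mpolyC n K) (fun i => 'X_i *: 'X)).

Lemma gradeE : grade = mmap (polyC \o @mpolyC n K) (fun i => 'X_i *: 'X).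
Proof. exact: unlock. Qed.

Lemma grade_is_additive : additive grade.
Proof. by rewrite gradeE; apply: raddfB. Qed.

Lemma grade_is_multiplicative : multiplicative grade.
Proof. by rewrite gradeE; split; [apply: rmorphM | apply: rmorph1]. Qed.

HB.instance Definition _ := GRing.isAdditive.Build A {poly A} grade grade_is_additive.
HB.instance Definition _ :=
  GRing.isMultiplicative.Build A {poly A} grade grade_is_multiplicative.

Lemma gradeC c : grade c%:MP = (c%:MP)%:P.
Proof. by rewrite gradeE; apply: mmapC. Qed.

Lemma gradeX m : grade 'X_[m] = 'X_[m] *: 'X^(mdeg m).
Proof.
rewrite gradeE mmapX /mmap1 mpolyXE_id mdegE.
elim/big_rec3: _ => [|i u v w _ ->]; first by rewrite expr0 alg_polyC.
by rewrite exprZn exprD -scalerAl -scalerAr scalerA.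
Qed.

Lemma gradeZ c p : grade (c *: p) = c%:MP *: grade p.
Proof. by rewrite -mul_mpolyC rmorphM /= gradeC mul_polyC. Qed.

Lemma mcoeff_grade p d m : ((grade p)`_d)@_m = p@_m *+ (mdeg m == d).
Proof.
rewrite {1}[p]mpolyE rmorph_sum coef_sum raddf_sum /=.
have [ms|ms] := boolP (m \in msupp p); last first.
  rewrite big_seq big1 ?memN_msupp_eq0 // ?mul0rn // => m' m's.
  rewrite gradeZ gradeX !coefZ coefXn mcoeffCM.
  case: eqP => _; rewrite ?mulr0 ?mcoeff0 ?mulr0 // mulr1 mcoeffX.
  by case: eqP => [E|]; rewrite ?mulr0 //; rewrite E (negPf ms) in m's.
rewrite (bigD1_seq m) ?msupp_uniq //= big1 ?addr0 => [|m' m'm].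
  rewrite gradeZ gradeX !coefZ coefXn mcoeffCM eq_sym.
  by case: eqP => _; rewrite ?mulr0 ?mcoeff0 ?mulr0 // mulr1 mcoeffX eqxx mulr1.
rewrite gradeZ gradeX !coefZ coefXn mcoeffCM.
case: eqP => _; rewrite ?mulr0 ?mcoeff0 ?mulr0 // mulr1 mcoeffX.
by rewrite (negPf m'm) mulr0.
Qed.

Lemma size_grade p : size (grade p) = msize p.
Proof.
apply/eqP; rewrite eqn_leq; apply/andP; split.
  apply/leq_sizeP => d pd; apply/mpolyP => m; rewrite mcoeff_grade mcoeff0.
  case: eqP => // md; rewrite memN_msupp_eq0 //.
  by apply: msize_mdeg_ge; rewrite md.
have [->|p0] := eqVneq p 0; first by rewrite msize0.
rewrite -mlead_deg //; apply: contraR p0; rewrite -leqNgt => sp.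
rewrite -mleadc_eq0; apply/eqP.
by have := mcoeff_grade p (mdeg (mlead p)) (mlead p); rewrite eqxx nth_default ?mcoeff0.
Qed.

Lemma grade_coef p d : grade (grade p)`_d = (grade p)`_d *: 'X^d.
Proof.
apply/polyP => e; apply/mpolyP => m; rewrite mcoeff_grade coefZ coefXn.
have [->|ed] := eqVneq e d; last first.
  rewrite mulr0 mcoeff0 mcoeff_grade.
  by case: eqP => // me; case: eqP => // md; rewrite -me md eqxx in ed.
by rewrite mulr1 mcoeff_grade; case: eqP.
Qed.

End Grading.

(** * Forms with no common zero but the origin *)

Lemma coefM_top (B : nzRingType) (p q : {poly B}) a b :
  (size p <= a.+1)%N -> (size q <= b.+1)%N -> (p * q)`_(a + b) = p`_a * q`_b.
Proof.
move=> pa qb; have ab : (a < (a + b).+1)%N by lia.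
rewrite coefM (bigD1 (Ordinal ab)) //= addKn big1 ?addr0 // => i.
rewrite -val_eqE /= => ia; have [ai|ia'] := ltnP a i.
  by rewrite (nth_default 0 (leq_trans pa ai)) mul0r.
have bi : (b < a + b - i)%N by lia.
by rewrite (nth_default 0 (leq_trans qb bi)) mulr0.
Qed.

(** Regularity of a sequence of forms F_i of degrees k_i in a usable form: the
    relation that expresses u can be chosen homogeneous. *)
Definition graded_regular (K : fieldType) (n : nat) (k : nat -> nat)
    (F : nat -> {mpoly K[n]}) : Prop :=
  forall s d u, (s < n)%N -> grade u = u *: 'X^d -> fg_ideal F s (F s * u) ->
  exists g : nat -> {mpoly K[n]}, u = \sum_(i < s) g i * F i /\
    forall i, if (k i <= d)%N then grade (g i) = g i *: 'X^(d - k i) else g i = 0.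

(** The n forms F_j (j < s), F_j^(d+1) (j > s) and F_s have the same zeros as
    F.  So u belongs to the ideal of the first n - 1 of them, and the powers
    F_j^(d+1) drop out of the component of degree d. *)
Lemma finite_zeros_graded_regular (K : closedFieldType) (n : nat)
    (k : nat -> nat) (F : nat -> {mpoly K[n]}) :
    uncountable K -> (forall j, (j < n)%N -> (0 < k j)%N) ->
    (forall j, (j < n)%N -> grade (F j) = F j *: 'X^(k j)) -> finite_zeros F n ->
  graded_regular k F.
Proof.
move=> uncK k0 homF [bad fin] s d u sn homu Fu.
pose b j := if (j < s)%N then F j else if (j < n.-1)%N then F j.+1 ^+ d.+1 else F s.
have bs j : (j < s)%N -> b j = F j by rewrite /b => ->.
have bl : b n.-1 = F s by rewrite /b ltnn; case: ltnP => //; lia.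
have bge i : (s <= i)%N -> (i < n.-1)%N -> b i = F i.+1 ^+ d.+1.
  by move=> si i1; rewrite /b ltnNge si i1.
have finb : finite_zeros b n.
  exists bad => x bx; apply: fin => j jn.
  have [js|] := ltnP j s; first by rewrite -bs // bx.
  rewrite leq_eqVlt => /predU1P[<-|sj]; first by rewrite -bl bx //; lia.
  have := bx j.-1; rewrite bge ?prednK; try lia.
  by move=> bxj; have /eqP := bxj ltac:(lia); rewrite rmorphXn expf_eq0 /= => /eqP.
have [||G Eu] := finite_zeros_last_regular (k := n.-1) (u := u) uncK _ finb.
- by lia.
- rewrite bl; apply: sub_fg_ideal Fu => i si; rewrite -bs //; apply: mem_fg_ideal; lia.
pose g i := if (k i <= d)%N then (grade (G i))`_(d - k i) else 0.
exists g; split; last first.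
  by move=> i; rewrite /g; case: ltnP => // _; rewrite grade_coef.
have -> : u = (grade u)`_d by rewrite homu coefZ coefXn eqxx mulr1.
rewrite {1}Eu rmorph_sum coef_sum /=.
rewrite (bigID (fun i : 'I__ => (i < s)%N)) /= [X in _ + X]big1 ?addr0; last first.
  move=> i; rewrite -leqNgt => si; rewrite rmorphM /= bge // rmorphXn /=.
  rewrite homF; last by have := ltn_ord i; lia.
  rewrite exprZn -scalerAr coefZ -exprM coefMXn ifT ?mulr0 //.
  have : (0 < k i.+1)%N by apply: k0; have := ltn_ord i; lia.
  by nia.
have sn1 : (s <= n.-1)%N by lia.
rewrite (big_ord_narrow sn1) /=; apply: eq_bigr => i _.
rewrite rmorphM /= bs ?ltn_ord // homF; last by have := ltn_ord i; lia.
rewrite -scalerAr coefZ coefMXn /g mulrC.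
by rewrite ltnNge; case: leqP => //=; rewrite ?mul0r.
Qed.

(** * Lowering degrees *)

Section LowerDegree.
Variables (K : fieldType) (n : nat) (k : nat -> nat) (f : nat -> {mpoly K[n]}).
Local Notation A := {mpoly K[n]}.
Hypothesis fk : forall j, (j < n)%N -> (msize (f j) <= (k j).+1)%N.
Hypothesis reg : graded_regular k (fun j => (grade (f j))`_(k j)).

(** If the terms of degree D cancel, the leading form H_s of h_s is a
    combination sum_i g_i F_i of the previous leading forms.  Adding g_i f_s to
    h_i and subtracting sum_i g_i f_i from h_s does not change the sum, and it
    lowers the degree of h_s; then one proceeds with the other h_i. *)
Lemma lower_degree s D (h : nat -> A) :
    (s <= n)%N -> (forall i, (i < s)%N -> (msize (h i) <= D.+1 - k i)%N) ->
    (msize (\sum_(i < s) h i * f i) <= D)%N ->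
  exists2 h' : nat -> A, \sum_(i < s) h i * f i = \sum_(i < s) h' i * f i &
    forall i, (i < s)%N -> (msize (h' i) <= D - k i)%N.
Proof.
elim: s h => [|s IH] h sn hD sumD; first by exists h.
pose F j := (grade (f j))`_(k j); pose d := (D - k s)%N.
pose H i := if (k i <= D)%N then (grade (h i))`_(D - k i) else 0.
have top i : (i < s.+1)%N -> (grade (h i * f i))`_D = H i * F i.
  move=> si; rewrite rmorphM /= /H; have hi := hD i si; have fi := fk (leq_trans si sn).
  case: leqP => kD; last first.
    have -> : h i = 0 by apply/eqP; rewrite -msize_poly_eq0; lia.
    by rewrite rmorph0 !mul0r coef0.
  by rewrite -{1}(subnK kD) coefM_top ?size_grade //; lia.
have sumHF : \sum_(i < s.+1) H i * F i = 0.
  rewrite -[RHS](nth_default 0 (_ : size (grade (\sum_(i < s.+1) h i * f i)) <= D)%N) ?size_grade //.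
  by rewrite rmorph_sum coef_sum; apply: eq_bigr => i _; rewrite -top.
have HsFs : H s * F s = - \sum_(i < s) H i * F i.
  by apply/eqP; rewrite -addr_eq0 addrC; move: sumHF; rewrite big_ord_recr /= => ->.
have [g EH homg] : exists2 g : nat -> A, H s = \sum_(i < s) g i * F i &
    forall i, if (k i + k s <= D)%N then grade (g i) = g i *: 'X^(d - k i) else g i = 0.
  have [ksD|Dks] := leqP (k s) D; last first.
    exists (fun=> 0); first by rewrite /H leqNgt Dks big1 // => i _; rewrite mul0r.
    by move=> i; case: ifP; rewrite ?rmorph0 ?scale0r.
  have [||g [EH homg]] := reg (s := s) (d := d) (u := H s) sn.
  - by rewrite /H ksD grade_coef.
  - change (fg_ideal F s (F s * H s)); exists (fun i => - H i).
    rewrite [F s * H s]mulrC HsFs -sumrN.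
    by apply: eq_bigr => i _; rewrite mulNr.
  - exists g => // i; have := homg i; rewrite /d.
    by have -> : (k i <= D - k s)%N = (k i + k s <= D)%N by lia.
pose t := h s - \sum_(i < s) g i * f i.
have gD i : (msize (g i) <= D.+1 - k i - k s)%N.
  have := homg i; case: leqP => [kD homgi|_ ->]; last by rewrite msize0.
  rewrite -size_grade homgi; apply: leq_trans (size_scale_leq _ _) _.
  by rewrite size_polyXn /d; lia.
have fs := fk sn.
have td : (msize t <= D - k s)%N.
  rewrite -size_grade; apply/leq_sizeP => e de.
  rewrite rmorphB coefB rmorph_sum [X in _ - X]coef_sum.
  have hs := hD s (ltnSn s).
  have [ed|ne] := eqVneq e d; last first.
    rewrite nth_default ?size_grade; last by move: ne; rewrite /d; lia.
    rewrite big1 ?subr0 // => i _; have fi := fk (ltn_trans (ltn_ord i) sn).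
    have [-> |g0] := eqVneq (g i) 0; first by rewrite mul0r rmorph0 coef0.
    rewrite nth_default // rmorphM /=; apply: leq_trans (size_polyMleq _ _) _.
    move: g0; rewrite !size_grade -msize_poly_eq0.
    by have := gD i; move: ne; rewrite /d; lia.
  have [ksD|Dks] := leqP (k s) D; last first.
    rewrite nth_default ?size_grade; last by lia.
    rewrite big1 ?subr0 // => i _; have gi := gD i.
    have -> : g i = 0 by apply/eqP; rewrite -msize_poly_eq0; lia.
    by rewrite mul0r rmorph0 coef0.
  have -> : (grade (h s))`_e = H s by rewrite /H ksD ed.
  rewrite EH -sumrB big1 // => i _; have := homg i; have fi := fk (ltn_trans (ltn_ord i) sn).
  case: leqP => [kD homgi|_ ->]; last by rewrite !mul0r rmorph0 coef0 subrr.
  rewrite rmorphM /= homgi -scalerAl coefZ mulrC coefXnM ed.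
  rewrite ifF; last by rewrite /d; lia.
  have -> : (d - (d - k i))%N = k i by rewrite /d; lia.
  by rewrite -/(F i) [g i * _]mulrC subrr.
have [i si||h' Eh' hD'] := IH (fun i => h i + g i * f s) (ltnW sn).
- apply: leq_trans (msizeD_le _ _) _; rewrite geq_max hD ?leqW //=.
  have [-> |g0] := eqVneq (g i) 0; first by rewrite mul0r msize0.
  rewrite -size_grade rmorphM /=; apply: leq_trans (size_polyMleq _ _) _.
  move: g0; rewrite !size_grade -msize_poly_eq0; have := gD i; lia.
- have -> : \sum_(i < s) (h i + g i * f s) * f i = \sum_(i < s.+1) h i * f i - t * f s.
    rewrite big_ord_recr /= /t mulrBl opprB addrACA subrr addr0 mulr_suml -big_split /=.
    by apply: eq_bigr => i _; ring.
  apply: leq_trans (msizeD_le _ _) _; rewrite geq_max sumD msizeN /=.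
  have [-> |t0] := eqVneq t 0; first by rewrite mul0r msize0.
  rewrite -size_grade rmorphM /=; apply: leq_trans (size_polyMleq _ _) _.
  move: t0; rewrite !size_grade -msize_poly_eq0; lia.
exists (fun i => if i == s then t else h' i) => [|i].
  rewrite [RHS]big_ord_recr /= eqxx.
  under [X in _ = X + _]eq_bigr => i _ do rewrite ltn_eqF //.
  rewrite -Eh' big_ord_recr /= /t mulrBl mulr_suml addrCA addrC; congr (_ + _).
  by rewrite -sumrN -big_split /=; apply: eq_bigr => i _; ring.
by rewrite ltnS leq_eqVlt; case: eqP => [-> _|_ /hD'].
Qed.

Lemma lower_degrees s (h : nat -> A) : (s <= n)%N ->
  exists2 h' : nat -> A, \sum_(i < s) h i * f i = \sum_(i < s) h' i * f i &
    forall i, (i < s)%N -> (msize (h' i) <= msize (\sum_(i < s) h i * f i) - k i)%N.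
Proof.
move=> sn; set p := \sum_(i < s) _.
have [e he] : exists e, forall i, (i < s)%N -> (msize (h i) <= msize p + e - k i)%N.
  exists (\max_(i < s) (msize (h i) + k i))%N => i si.
  have := leq_bigmax (F := fun i : 'I_s => (msize (h i) + k i)%N) (Ordinal si).
  by move: (\max_(_ < _) _)%N => M /=; lia.
suff key : forall (h0 : nat -> A) (q : A), q = \sum_(i < s) h0 i * f i ->
    (forall i, (i < s)%N -> (msize (h0 i) <= msize q + e - k i)%N) ->
    exists2 h' : nat -> A, q = \sum_(i < s) h' i * f i &
      forall i, (i < s)%N -> (msize (h' i) <= msize q - k i)%N.
  exact: key.
elim: e {he} => [|e IH] h0 q Eq hq.
  by exists h0 => // i; rewrite -[X in (X - _)%N]addn0; apply: hq.
have [i si||h' Eh'] := lower_degree (D := (msize q + e)%N) (h := h0) sn.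
- by rewrite -addnS; apply: hq.
- by rewrite -Eq leq_addr.
by rewrite -Eq in Eh' => /(IH _ _ Eh').
Qed.

End LowerDegree.

(** * No common zero at infinity *)

Lemma size_polyM_bound (B : nzRingType) (p q : {poly B}) a b :
  (size p <= a)%N -> (size q <= b)%N -> (size (p * q)%R <= (a + b).-1)%N.
Proof. by move=> pa qb; apply: leq_trans (size_polyMleq _ _) _; lia. Qed.

Lemma msizeM_bound (K : fieldType) n (p q : {mpoly K[n]}) a b :
  (msize p <= a)%N -> (msize q <= b)%N -> (msize (p * q)%R <= (a + b).-1)%N.
Proof. by rewrite -!size_grade rmorphM; apply: size_polyM_bound. Qed.

Section MpolyMisc.
Variables (K : fieldType) (n : nat).
Local Notation A := {mpoly K[n]}.

Lemma msize_monomial_comp (y : 'I_n -> A) (m : 'X_{1..n}) :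
  (forall i, (msize (y i) <= 2)%N) -> (msize (\prod_i y i ^+ m i) <= (mdeg m).+1)%N.
Proof.
move=> y2; rewrite mdegE.
elim/big_rec2: _ => [|i p d _ pd]; first by rewrite msize1.
suff ymi : (msize (y i ^+ m i) <= (m i).+1)%N.
  by apply: leq_trans (msizeM_bound ymi pd) _; lia.
elim: (m i) => [|e IH]; first by rewrite expr0 msize1.
by rewrite exprS; apply: leq_trans (msizeM_bound (y2 i) IH) _; lia.
Qed.

Lemma lagrange (pts : seq 'rV[K]_n) (z : 'rV[K]_n) :
  exists g : A, forall x, x \in pts -> (g.@[x ord0] == 0) = (x != z).
Proof.
pose sep (x : 'rV[K]_n) : A :=
  if [pick i | z ord0 i != x ord0 i] is Some i then 'X_i - (x ord0 i)%:MP else 1.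
have sepz x : x != z -> (sep x).@[z ord0] != 0.
  rewrite /sep; case: pickP => [i zx _|_ _]; last by rewrite meval1 oner_eq0.
  by rewrite mevalB mevalXU mevalC subr_eq0.
have sepx x : x != z -> (sep x).@[x ord0] = 0.
  rewrite /sep; case: pickP => [i _ _|E /eqP[]]; first by rewrite mevalB mevalXU mevalC subrr.
  by apply/rowP => i; move/negbFE/eqP: (E i) => ->.
exists (\prod_(x <- pts | x != z) sep x) => x xpts; rewrite rmorph_prod /=.
have [->|xz] := eqVneq x z.
  by apply/negbTE; rewrite prodf_seq_neq0; apply/allP => t _; apply/implyP/sepz.
by apply/eqP; rewrite (big_rem x) //= xz sepx // mul0r.
Qed.

Lemma coef_param (B : comNzRingType) (c : {poly B}) (x z : B) d :
  (c * (x%:P + 'X * z%:P))`_d = c`_d * x + (if d is e.+1 then c`_e else 0) * z.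
Proof.
rewrite mulrDr coefD coefMC mulrA coefMC coefMX.
by case: d => [|d] /=; rewrite ?mul0r.
Qed.

End MpolyMisc.

Section AtInfinity.
Variables (K : fieldType) (n : nat) (v : 'I_n -> K) (r : 'I_n).
Hypothesis vr : v r != 0.
Local Notation A := {mpoly K[n]}.

(** The restriction of p to the line spanned by v, as a polynomial in the
    coordinate T of T v. *)
Definition on_line : A -> {poly K} := map_poly (meval v) \o @grade K n.

HB.instance Definition _ := GRing.RMorphism.copy on_line on_line.

Lemma on_lineZ c p : on_line (c *: p) = c *: on_line p.
Proof. by rewrite /on_line /= gradeZ map_polyZ /= mevalC. Qed.

Lemma on_lineB p q : on_line (p - q) = on_line p - on_line q.
Proof. exact: rmorphB. Qed.

Lemma on_lineX i : on_line 'X_i = v i *: 'X.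
Proof. by rewrite /on_line /= gradeX map_polyZ /= mdeg1 map_polyX mevalXU. Qed.

Lemma size_on_line p : (size (on_line p) <= msize p)%N.
Proof. by rewrite -size_grade size_poly. Qed.

Lemma coef_on_line p d : (on_line p)`_d = ((grade p)`_d).@[v].
Proof. by rewrite /on_line coef_map. Qed.

(** Linear coordinates in which v is a multiple of the r-th basis vector. *)
Definition adapted (i : 'I_n) : A :=
  if i == r then 'X_r else 'X_i - (v i / v r) *: 'X_r.

Lemma msize_adapted i : (msize (adapted i) <= 2)%N.
Proof.
rewrite /adapted; case: eqP => _; first by rewrite msizeX mdeg1.
rewrite (leq_trans (msizeD_le _ _)) // geq_max msizeN msizeX mdeg1 /=.
by rewrite (leq_trans (msizeZ_le _ _)) // msizeX mdeg1.
Qed.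

Lemma on_line_adapted i : i != r -> on_line (adapted i) = 0.
Proof.
move=> ir; rewrite /adapted (negPf ir) on_lineB on_lineZ !on_lineX scalerA divfK //.
by rewrite subrr.
Qed.

Definition adapted_subst : A -> A := comp_mpoly [tuple adapted i | i < n].

HB.instance Definition _ := GRing.LRMorphism.copy adapted_subst adapted_subst.

Lemma adapted_substX m : adapted_subst 'X_[m] = \prod_i adapted i ^+ m i.
Proof. by rewrite /adapted_subst comp_mpolyX; apply: eq_bigr => i _; rewrite tnth_mktuple. Qed.

Lemma adapted_substU i : adapted_subst 'X_i = adapted i.
Proof. by rewrite /adapted_subst comp_mpolyXU -tnth_nth tnth_mktuple. Qed.

Lemma msize_adapted_subst m : (msize (adapted_subst 'X_[m]) <= (mdeg m).+1)%N.
Proof. by rewrite adapted_substX; apply/msize_monomial_comp/msize_adapted. Qed.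

Lemma adapted_subst_inj : injective adapted_subst.
Proof.
pose y' i : A := if i == r then 'X_r else 'X_i + (v i / v r) *: 'X_r.
pose tau := comp_mpoly [tuple y' i | i < n].
have tauU i : tau 'X_i = y' i by rewrite /tau comp_mpolyXU -tnth_nth tnth_mktuple.
apply: (can_inj (g := tau)) => p.
rewrite [RHS]mpolyE [adapted_subst p]comp_mpolyEX /tau.
rewrite (big_morph _ (comp_mpolyD _) (comp_mpoly0 _)).
apply: eq_bigr => m _; rewrite comp_mpolyZ -/tau -/(adapted_subst _); congr (_ *: _).
rewrite adapted_substX /tau rmorph_prod -/tau [RHS]mpolyXE_id; apply: eq_bigr => i _ /=.
rewrite rmorphXn /= -/tau /adapted; congr (_ ^+ _); case: eqP => [->|/eqP ir].
  by rewrite tauU /y' eqxx.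
by rewrite /tau comp_mpolyB comp_mpolyZ -/tau !tauU /y' eqxx (negPf ir) addrK.
Qed.

Lemma on_line_adapted_subst_eq0 (m : 'X_{1..n}) i :
  i != r -> (0 < m i)%N -> on_line (adapted_subst 'X_[m]) = 0.
Proof.
move=> ir mi; rewrite adapted_substX rmorph_prod (bigD1 i) //= rmorphXn /= on_line_adapted //.
by rewrite expr0n eqn0Ngt mi mul0r.
Qed.

(** There are as many rows u_a + t w_a as monomials of degree at most E, but all
    of them lie in the hyperplane of the polynomials whose component of degree E
    vanishes at v.  So their determinant is zero and they are linearly
    dependent over K[t]. *)
Lemma hyperplane_relation (E : nat) (u w : 'X_{1..n < E.+1} -> A) :
    (forall a, (msize (u a) <= E.+1)%N /\ (msize (w a) <= E.+1)%N) ->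
    (forall a, (on_line (u a))`_E = 0 /\ (on_line (w a))`_E = 0) ->
  exists c : 'X_{1..n < E.+1} -> {poly K}, (exists a, c a != 0) /\
    \sum_a map_poly (@mpolyC n K) (c a) * ((u a)%:P + 'X * (w a)%:P) = 0.
Proof.
move=> uwE uw0; pose D := #|{: 'X_{1..n < E.+1}}|.
pose mon (a : 'I_D) : 'X_{1..n < E.+1} := enum_val a.
pose M : 'M[{poly K}]_D := \matrix_(a, b)
  (((u (mon a))@_(mon b))%:P + 'X * ((w (mon a))@_(mon b))%:P).
have psiE p : (msize p <= E.+1)%N -> (on_line p)`_E =
    \sum_(b < D) p@_(mon b) * (on_line 'X_[mon b])`_E.
  move=> pE; rewrite [in LHS](mpolywE pE) rmorph_sum coef_sum.
  rewrite (reindex mon) /=; last exact/onW_bij/enum_val_bij.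
  by apply: eq_bigr => b _; rewrite on_lineZ coefZ.
have detM : \det M = 0.
  rewrite -det_tr; apply/eqP/det0P.
  exists (\row_b ((on_line 'X_[mon b])`_E)%:P).
    apply/rV0Pn; have rE : (mdeg (U_(r) *+ E : 'X_{1..n})%MM < E.+1)%N.
      by rewrite mdegMn mdeg1 mul1n.
    exists (enum_rank (BMultinom rE)); rewrite mxE /mon enum_rankK /= polyC_eq0.
    rewrite -mpolyXn rmorphXn /= on_lineX exprZn coefZ coefXn eqxx mulr1.
    by rewrite expf_neq0.
  apply/rowP => a; rewrite !mxE; have [ua wa] := uwE (mon a).
  have [u0 w0] := uw0 (mon a).
  transitivity (((on_line (u (mon a)))`_E)%:P + 'X * ((on_line (w (mon a)))`_E)%:P).
    rewrite !psiE // !rmorph_sum mulr_sumr -big_split; apply: eq_bigr => b _ /=.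
    by rewrite !mxE !polyCM; ring.
  by rewrite u0 w0 mulr0 addr0.
have /eqP/det0P[c c0 cM] := detM.
exists (fun a => c ord0 (enum_rank a)); split.
  by have /rV0Pn[a ca] := c0; exists (mon a); rewrite /mon enum_valK.
apply/polyP => d; apply/mpolyP => m; rewrite coef0 mcoeff0 coef_sum raddf_sum /=.
have [mE|Em] := ltnP (mdeg m) E.+1; last first.
  apply: big1 => a _; have [ua wa] := uwE a; rewrite coef_param mcoeffD.
  have cK (q : {poly K}) (p : A) e : (msize p <= E.+1)%N ->
      ((map_poly (@mpolyC n K) q)`_e * p)@_m = 0.
    move=> pE; rewrite coef_map /= mcoeffCM memN_msupp_eq0 ?mulr0 //.
    exact/msize_mdeg_ge/(leq_trans pE).
  by case: d => [|d]; rewrite !cK ?mul0r ?mcoeff0 ?addr0.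
have /matrixP/(_ ord0 (enum_rank (BMultinom mE))) := cM.
rewrite !mxE => /(congr1 (fun p : {poly K} => p`_d)); rewrite coef0 coef_sum => cM0.
rewrite -[RHS]cM0.
rewrite (reindex mon) /=; last exact/onW_bij/enum_val_bij.
apply: eq_bigr => b _; rewrite !mxE !coef_param /mon enum_valK enum_rankK /=.
rewrite mcoeffD coef_map /= mcoeffCM; congr (_ + _).
by case: d {cM0} => [|d]; rewrite ?mul0r ?mcoeff0 // coef_map /= mcoeffCM.
Qed.

End AtInfinity.

(** In degree E of the homogenized ring, these are the monomials not divisible
    by any x_i^(k_i), i <> r, nor by the k_r-th power of the homogenizing
    variable.  The exponent of the latter is E - mdeg a, and that of x_r is
    determined by the others. *)
Lemma card_box (n E : nat) (r : 'I_n) (k : nat -> nat) :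
    (forall i, (i < n)%N -> (0 < k i)%N) ->
  (#|[pred a : 'X_{1..n < E.+1} |
      [forall (i | i != r), (a i < k i)%N] && (E < mdeg a + k r)%N]| <= \prod_(i < n) k i)%N.
Proof.
move=> k0; have k0' (i : 'I_n) : (0 < k i)%N by apply: k0.
pose T := {dffun forall i : 'I_n, 'I_(k i)}.
have -> : (\prod_(i < n) k i = #|T|)%N.
  rewrite card_dep_ffun foldrE big_map big_enum /=.
  by apply: eq_bigr => i _; rewrite card_ord.
pose phi (a : 'X_{1..n < E.+1}) : T :=
  [ffun i => Ordinal (ltn_pmod (if i == r then E - mdeg a else a i)%N (k0' i))].
apply: leq_trans (max_card (mem (phi @: [pred a : 'X_{1..n < E.+1} |
      [forall (i | i != r), (a i < k i)%N] && (E < mdeg a + k r)%N]))).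
rewrite card_in_imset // => a b; rewrite !inE.
move=> /andP[/forall_inP ak aE] /andP[/forall_inP bk bE] /ffunP eab.
have ab i : i != r -> a i = b i.
  move=> ir; have := congr1 val (eab i); rewrite !ffunE /= (negPf ir).
  by rewrite !modn_small ?ak ?bk.
have dab : mdeg a = mdeg b.
  have := congr1 val (eab r); rewrite !ffunE /= eqxx.
  have := bmdeg a; have := bmdeg b; have := k0' r => kr bE' aE'.
  by rewrite !modn_small; lia.
apply: val_inj; apply/mnmP => i; have [->|/ab //] := eqVneq i r.
move: dab; rewrite !mdegE (bigD1 r) //= [RHS](bigD1 r) //=.
by rewrite (eq_bigr (fun i => b i)) ?[(b r + _)%N]addnC ?[(a r + _)%N]addnC => [/addnI|j /ab].
Qed.

Section NoZeroAtInfinity.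
Variables (K : closedFieldType) (n : nat).
Hypothesis uncK : uncountable K.
Local Notation A := {mpoly K[n]}.
Variables (f : nat -> A) (k : nat -> nat) (pts : seq 'rV[K]_n).
Hypothesis k0 : forall i, (i < n)%N -> (0 < k i)%N.
Hypothesis fk : forall i, (i < n)%N -> (msize (f i) <= (k i).+1)%N.
Hypothesis uniq_pts : uniq pts.
Hypothesis size_pts : size pts = (\prod_(i < n) k i)%N.
Hypothesis pts_zeros : forall x : 'rV[K]_n,
  x \in pts <-> (forall i, (i < n)%N -> (f i).@[x ord0] = 0).

Lemma finite_zeros_pts : finite_zeros f n.
Proof.
exists [seq (x : 'rV[K]_n) ord0 i | x <- pts, i <- enum 'I_n] => x fx i.
have xpts : \row_j x j \in pts.
  by apply/pts_zeros => j jn; rewrite -[RHS](fx j jn); apply: meval_eq => l; rewrite mxE.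
apply/allpairsP; exists (\row_j x j, i); split=> //=; last by rewrite mxE.
by rewrite mem_enum.
Qed.

(** Evaluating a relation at t = 0 and at the point z_a, only the term of index
    a survives, so all c_a vanish at t = 0.  As t can be cancelled modulo F
    ([finite_zeros_param_regular]), the quotients c_a / t satisfy a relation
    too, and one concludes by induction on the degree of the c_a. *)
Lemma separating_independent (F : nat -> {poly A}) (T : finType) (L : {pred T})
    (g : T -> A) (z : T -> 'rV[K]_n) (c : T -> {poly K}) :
    (forall j, (j < n)%N -> (F j).[0] = f j) ->
    (forall a, a \in L -> z a \in pts) ->
    (forall a b, a \in L -> b \in L -> ((g a).@[z b ord0] == 0) = (b != a)) ->
    fg_ideal F n (\sum_(a in L) map_poly (@mpolyC n K) (c a) * (g a)%:P) ->
  forall a, a \in L -> c a = 0.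
Proof.
move=> F0 zL gz; have [B] : exists B, forall a, a \in L -> (size (c a) <= B)%N.
  by exists (\max_a size (c a))%N => a _; apply: leq_bigmax.
elim: B c => [|B IH] c cB cF a aL; first by have := cB a aL; rewrite leqn0 size_poly_eq0 => /eqP.
have c0 b : b \in L -> (c b).[0] = 0.
  move=> bL; case: cF => G /(congr1 (fun p : {poly A} => p.[0].@[z b ord0])).
  rewrite !horner_sum !raddf_sum /= [in RHS]big1 => [|i _]; last first.
    by rewrite hornerM F0 // mevalM (pts_zeros (z b)).1 ?zL // mulr0.
  rewrite (bigD1 b) //= big1 ?addr0 => [|d /andP[dL db]]; last first.
    have /eqP gd : (g d).@[z b ord0] == 0 by rewrite gz // eq_sym.
    by rewrite hornerM hornerC mevalM gd mulr0.
  rewrite hornerM hornerC mevalM => /eqP; rewrite mulf_eq0 gz // eqxx orbF.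
  by rewrite -[X in _.[X]](mpolyC0 n) horner_map mevalC => /eqP.
have /boolp.choice[c' Ec'] b : exists p, c b = ((c b).[0])%:P + 'X * p.
  exact: poly_at0_decomp.
have cX b : b \in L -> c b = 'X * c' b by move=> bL; rewrite {1}Ec' c0 // add0r.
rewrite cX // (IH c') ?mulr0 // => [b bL|].
  have := cB b bL; rewrite cX //; have [->|c'0] := eqVneq (c' b) 0; first by rewrite size_poly0.
  by rewrite mulrC size_mulX.
apply: finite_zeros_param_regular => //.
  have [bad fin] := finite_zeros_pts; exists bad => x Fx; apply: fin => j jn.
  by rewrite -F0 ?Fx.
congr (fg_ideal F n _): cF; rewrite mulr_sumr; apply: eq_bigr => b bL.
by rewrite cX // rmorphM /= map_polyX mulrA.
Qed.

(** The rows are multiples of the deformed equations F_i, one for each monomial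
    that is divisible by some y_i^(k_i), i <> r, or of degree at most E - k_r,
    with this monomial as coefficient of t; the set L of the other monomials has
    at most k_1 ... k_n elements ([card_box]), and their rows are polynomials
    g that separate the points.  In the relation of [hyperplane_relation], the
    coefficients on L vanish by [separating_independent]; then the terms of
    highest degree in t are a relation between distinct monomials in the
    adapted coordinates. *)
Theorem no_zero_at_infinity (v : 'I_n -> K) :
    (forall i, (i < n)%N -> ((grade (f i))`_(k i)).@[v] = 0) ->
  forall i, v i = 0.
Proof.
move=> fv r; apply/eqP; apply: contraT => vr.
have /boolp.choice[g Eg] (j : nat) : exists g : A,
    forall x, x \in pts -> (g.@[x ord0] == 0) = (x != pts`_j).
  exact: lagrange.
(* Any E such that all g j have degree less than E will do. *)
pose E := (\max_(j < size pts) msize (g j))%N.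
pose T := 'X_{1..n < E.+1}.
pose pk (a : T) := [pick i | (i != r) && (k i <= a i)%N].
pose L := [pred a : T | [forall (i | i != r), (a i < k i)%N] && (E < mdeg a + k r)%N].
pose idx a := index a (enum L).
have idxL a : a \in L -> (idx a < size pts)%N.
  move=> aL; rewrite size_pts; apply: leq_trans (card_box E r k0).
  by rewrite cardE index_mem mem_enum.
pose y := adapted_subst v r.
pose hh j : A := oapp (fun i : 'I_n => if i == r then 1 else adapted v r i ^+ k i) 0 (insub j).
pose F j : {poly A} := (f j)%:P + 'X * (hh j)%:P.
have F0 j : (F j).[0] = f j by rewrite !hornerE.
have hhE (i : 'I_n) : hh i = if i == r then 1 else adapted v r i ^+ k i by rewrite /hh valK.
pose u (a : T) := if pk a is Some i then y 'X_[a - U_(i) *+ k i] * f i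
  else if a \in L then g (idx a) else y 'X_[a] * f r.
pose w (a : T) := if a \in L then 0 else y 'X_[a].
have pkL a i : pk a = Some i -> [/\ i != r, (k i <= a i)%N & a \notin L].
  rewrite /pk; case: pickP => // j /andP[jr ja] [<-]; split=> //.
  rewrite inE negb_and; apply/orP; left; apply/negP => /forall_inP/(_ j jr).
  by rewrite ltnNge ja.
have pkN a : pk a = None -> a \notin L -> (mdeg a + k r <= E)%N.
  rewrite /pk; case: pickP => // aN _; rewrite inE negb_and -leqNgt => /orP[|//].
  move/negP; case; apply/forall_inP => i ir; rewrite ltnNge.
  by move: (aN i); rewrite ir /= => ->.
have psif i : (i < n)%N -> (size (on_line v (f i)) <= k i)%N.
  move=> i_n; apply/leq_sizeP => j; rewrite leq_eqVlt => /predU1P[<-|kj].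
    by rewrite coef_on_line fv.
  by rewrite nth_default //; apply: leq_trans (size_on_line _ _) (leq_trans (fk i_n) kj).
have mon_le (a : T) (i : 'I_n) : (k i <= a i)%N -> (U_(i) *+ k i <= a)%MM.
  move=> ka; apply/mnm_lepP => j; rewrite mulmnE mnm1E.
  by case: eqP => [<-|_]; rewrite ?mul1n ?mul0n.
have mdegB (a : T) (i : 'I_n) :
    (k i <= a i)%N -> (mdeg (a - U_(i) *+ k i)%MM + k i = mdeg a)%N.
  by move=> /mon_le/submK {2}<-; rewrite mdegD mdegMn mdeg1 mul1n.
have rowE a : a \notin L ->
    exists (s : A) (i : 'I_n), (u a)%:P + 'X * (w a)%:P = s%:P * F i.
  move=> aL; rewrite /u /w (negPf aL); case Epk : (pk a) => [i|].
    have [ir ka _] := pkL _ _ Epk; exists (y 'X_[a - U_(i) *+ k i]), i.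
    have Ey : y 'X_[a] = y 'X_[a - U_(i) *+ k i] * adapted v r i ^+ k i.
      rewrite -[in LHS](submK (mon_le _ _ ka)) mpolyXD /y (rmorphM (adapted_subst v r)) /=.
      by rewrite -mpolyXn (rmorphXn (adapted_subst v r)) /= adapted_substU.
    by rewrite /F hhE (negPf ir) Ey !polyCM; ring.
  exists (y 'X_[(a : T)]); exists r.
  by rewrite /F hhE eqxx !polyCM; ring.
have y_size m : (size (on_line v (y 'X_[m])) <= (mdeg m).+1)%N.
  exact: leq_trans (size_on_line _ _) (msize_adapted_subst _ _ _).
have gE a : a \in L -> (msize (g (idx a)) <= E)%N.
  move=> aL.
  exact: (leq_bigmax (F := fun j : 'I_(size pts) => msize (g j)) (Ordinal (idxL _ aL))).
have [||c [[a0 ca0] crel]] := hyperplane_relation (E := E) (u := u) (w := w) vr.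
- move=> a; have := bmdeg a => aE; split; last first.
    rewrite /w; case: ifP => _; first by rewrite msize0.
    exact: leq_trans (msize_adapted_subst _ _ _) aE.
  rewrite /u; case Epk : (pk a) => [i|].
    have [ir ka _] := pkL _ _ Epk.
    apply: leq_trans (msizeM_bound (msize_adapted_subst _ _ _) (fk (ltn_ord i))) _.
    by move: aE; rewrite -(mdegB _ _ ka); lia.
  case: ifPn => aL; first by rewrite leqW ?gE.
  apply: leq_trans (msizeM_bound (msize_adapted_subst _ _ _) (fk (ltn_ord r))) _.
  by have := pkN _ Epk aL; lia.
- move=> a; have := bmdeg a => aE; split; last first.
    rewrite /w; case: ifPn => aL; first by rewrite rmorph0 coef0.
    case Epk : (pk a) => [i|].
      have [ir ka _] := pkL _ _ Epk; rewrite (on_line_adapted_subst_eq0 _ ir) ?coef0 //.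
      exact: leq_trans (k0 _) ka.
    rewrite nth_default //; apply: leq_trans (y_size _) _.
    by have := pkN _ Epk aL; have := k0 (ltn_ord r); lia.
  rewrite /u; case Epk : (pk a) => [i|].
    have [ir ka _] := pkL _ _ Epk; rewrite rmorphM /= nth_default //.
    apply: leq_trans (size_polyM_bound (y_size _) (psif _ (ltn_ord i))) _.
    by move: aE; rewrite -(mdegB _ _ ka); have := k0 (ltn_ord i); lia.
  case: ifPn => aL.
    by rewrite nth_default // (leq_trans (size_on_line _ _)) ?gE.
  rewrite rmorphM /= nth_default //.
  apply: leq_trans (size_polyM_bound (y_size _) (psif _ (ltn_ord r))) _.
  by have := pkN _ Epk aL; have := k0 (ltn_ord r); lia.
have cL a : a \in L -> c a = 0.
  apply: (separating_independent (F := F) (g := fun a => g (idx a))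
    (z := fun a => pts`_(idx a))) => //.
  - by move=> b bL; rewrite mem_nth ?idxL.
  - move=> b d bL dL; rewrite Eg ?mem_nth ?idxL // nth_uniq ?idxL //.
    congr (~~ _); apply/eqP/eqP => [|->//].
    by move/(congr1 (nth d (enum L))); rewrite !nth_index ?mem_enum.
  have -> : \sum_(b in L) map_poly (@mpolyC n K) (c b) * (g (idx b))%:P =
      - \sum_(b | b \notin L) map_poly (@mpolyC n K) (c b) * ((u b)%:P + 'X * (w b)%:P).
    apply/eqP; rewrite -addr_eq0; apply/eqP; rewrite -[RHS]crel [RHS](bigID (mem L)) /=.
    congr (_ + _); apply: eq_bigr => b bL; rewrite /u /w bL polyC0 mulr0 addr0.
    by case Epk : (pk b) => [i|//]; have [_ _ /negP[]] := pkL _ _ Epk.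
  apply: fg_idealN; apply: fg_ideal_sum => b /rowE[s [i ->]].
  by rewrite mulrA; apply: fg_idealM; apply: (mem_fg_ideal F).
have T0 : (0 < #|{: 'X_{1..n < E.+1}}|)%N by apply/card_gt0P; exists a0.
have [a1 Ea1] := eq_bigmax (fun a => size (c a)) T0.
case EB : (\max_a size (c a))%N Ea1 => [|B] Ea1.
  have := leq_bigmax (F := fun a => size (c a)) a0.
  by rewrite EB leqn0 size_poly_eq0 (negPf ca0).
have cB a : (size (c a) <= B.+1)%N by rewrite -EB (leq_bigmax (F := fun a => size (c a))).
(* As c vanishes on L, the coefficient of t^(B+1) in the relation is the sum of
   the w a multiplied by the coefficients of t^B in the c a. *)
suff /(congr1 (mcoeff a1)) : \sum_a (c a)`_B *: 'X_[a] = 0 :> A.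
  rewrite raddf_sum (bigD1 a1) //= big1 => [|a aa1]; last first.
    by rewrite mcoeffZ mcoeffX -bmeqP (negPf aa1) mulr0.
  rewrite mcoeffZ mcoeffX eqxx mulr1 addr0 mcoeff0 => ca1.
  have := lead_coef_eq0 (c a1); rewrite lead_coefE -Ea1 /= ca1 eqxx.
  by rewrite -size_poly_eq0 -Ea1.
apply: (@adapted_subst_inj _ _ v r); rewrite raddf0 raddf_sum /=.
have /(congr1 (fun p : {poly A} => p`_B.+1)) := crel.
rewrite coef0 coef_sum => cw; rewrite -[RHS]cw; apply: eq_bigr => a _.
rewrite coef_param !coef_map /= (nth_default 0 (cB a)) mpolyC0 mul0r add0r.
rewrite mul_mpolyC /w; case: ifPn => [aL|_]; last by rewrite linearZ.
by rewrite (cL a aL) coef0 !scale0r raddf0.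
Qed.

End NoZeroAtInfinity.

(** * Sufficiently intersecting hypersurfaces *)

(** Countable sets have Lebesgue measure zero. *)
Lemma real_uncountable (R : realType) (s : nat -> seq R) :
  exists x : R, forall d, x \notin s d.
Proof.
apply: boolp.contrapT => noex.
pose U := classical_sets.bigcup classical_sets.setT
            (fun d => classical_sets.mkset (fun x => x \in s d)).
have cU : cardinality.countable U.
  apply: cardinality.bigcup_countable => [|d _]; first exact: cardinality.countableP.
  apply: cardinality.finite_set_countable; exact: cardinality.finite_seq.
have all_U (x : R) : U x.
  apply: boolp.contrapT => nUx; apply: noex; exists x => d.
  by apply/negP => xd; apply: nUx; exists d.
have UT : U = classical_sets.mkset (fun x : R => x \in `]-oo, +oo[).
  by apply: boolp.funext => x; apply: boolp.propext; split=> _; rewrite //= in_itv.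
have := lebesgue_measure.countable_lebesgue_measure0 cU.
by rewrite UT lebesgue_measure.lebesgue_measure_itv.
Qed.

Lemma complex_uncountable (R : realType) : uncountable R[i].
Proof.
move=> s; have [x xs] := real_uncountable (fun d => [seq complex.Re z | z <- s d]).
exists (x +i* 0)%C => d; apply: contra (xs d) => xd.
by apply/mapP; exists (x +i* 0)%C.
Qed.

Lemma msize_hypersurface (K : nzRingType) (n : nat) (f : {mpoly K[n]}) k :
  hypersurface_of_degree f k -> [/\ (0 < k)%N, f != 0 & msize f = k.+1].
Proof.
rewrite /hypersurface_of_degree /mpdeg => -[k0]; case: eqVneq => // f0 [fk].
by split=> //; rewrite (mpolySpred _ f0) fk.
Qed.

Definition append_family (T : Type) (x0 : T) (s m : nat) (f : 'I_s -> T) (g : 'I_m -> T)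
    (j : nat) : T :=
  if insub j is Some i then f i else oapp g x0 (insub (j - s)%N).

Lemma append_familyl T x0 s m (f : 'I_s -> T) (g : 'I_m -> T) (i : 'I_s) :
  append_family x0 f g i = f i.
Proof. by rewrite /append_family valK. Qed.

Lemma append_familyr T x0 s m (f : 'I_s -> T) (g : 'I_m -> T) (i : 'I_m) :
  append_family x0 f g (s + i) = g i.
Proof.
by rewrite /append_family insubF ?addKn ?valK //= ltnNge leq_addr.
Qed.

Lemma forall_lt_add s m (P : nat -> Prop) :
    (forall i : 'I_s, P i) -> (forall i : 'I_m, P (s + i)%N) ->
  forall j, (j < s + m)%N -> P j.
Proof.
move=> Pf Pg j jsm; have [js|sj] := ltnP j s; first exact: (Pf (Ordinal js)).
have jm : (j - s < m)%N by lia.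
by rewrite -(subnKC sj); apply: (Pg (Ordinal jm)).
Qed.

Lemma Hbase_of_sufficiently_intersect (K : closedFieldType) (n s : nat)
    (k : 'I_s -> nat) (f : 'I_s -> {mpoly K[n]}) :
    uncountable K -> (s <= n)%N -> (forall i, hypersurface_of_degree (f i) (k i)) ->
  sufficiently_intersect k f -> is_Hbase f.
Proof.
move=> uncK sn hf [l [g [hg [pts [uniq_pts size_pts pts_zeros]]]]].
pose F := append_family 0 f g; pose d := append_family 1%N k l.
have Fd j : (j < n)%N -> [/\ (0 < d j)%N, F j != 0 & msize (F j) = (d j).+1].
  move: j; rewrite -{1}(subnKC sn); apply: forall_lt_add => i; rewrite /F /d.
    by rewrite !append_familyl; apply: msize_hypersurface.
  by rewrite !append_familyr; apply: msize_hypersurface.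
have d0 j : (j < n)%N -> (0 < d j)%N by move/Fd => [].
have Fsize j : (j < n)%N -> (msize (F j) <= (d j).+1)%N by move/Fd => [_ _ ->].
have prod_d : size pts = (\prod_(j < n) d j)%N.
  have split_prod (e : nat -> nat) m p : m = (s + p)%N ->
      (\prod_(j < m) e j = \prod_(i < s) e i * \prod_(j < p) e (s + j))%N.
    by move=> ->; rewrite big_split_ord.
  rewrite (split_prod _ _ _ (esym (subnKC sn))) size_pts; congr (_ * _)%N.
    by apply: eq_bigr => i _; rewrite /d append_familyl.
  by apply: eq_bigr => i _; rewrite /d append_familyr.
have ptsP (x : 'rV[K]_n) : x \in pts <-> (forall j, (j < n)%N -> (F j).@[x ord0] = 0).
  rewrite pts_zeros; split.
    move=> /andP[/forallP fx /forallP gx]; rewrite -{1}(subnKC sn).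
    apply: forall_lt_add => i; rewrite /F.
      by rewrite append_familyl; apply/eqP.
    by rewrite append_familyr; apply/eqP.
  move=> Fx; apply/andP; split; apply/forallP => i.
    by rewrite -(append_familyl 0 f g) Fx // (leq_trans _ sn).
  by rewrite -(append_familyr 0 f g) Fx // -ltn_subRL.
have top_regular : graded_regular d (fun j => (grade (F j))`_(d j)).
  apply: finite_zeros_graded_regular => // [j jn|]; first exact: grade_coef.
  exists [:: 0] => x /(no_zero_at_infinity uncK d0 Fsize uniq_pts prod_d ptsP) x0 i.
  by rewrite x0 mem_head.
have fN0 i : f i != 0 by have [] := msize_hypersurface (hf i).
split=> // p [h ->].
have [h' Eh' hdeg] := lower_degrees Fsize top_regular (fun j => oapp h 0 (insub j)) sn.
exists (fun i => h' i).
have sumE (q : nat -> {mpoly K[n]}) :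
    \sum_(i < s) q i * F i = \sum_(i < s) q i * f i.
  by apply: eq_bigr => i _; rewrite /F append_familyl.
have Eh : \sum_(i < s) h i * f i = \sum_(i < s) oapp h 0 (insub (val i)) * F i.
  by rewrite (sumE (fun j => oapp h 0 (insub j))); apply: eq_bigr => i _; rewrite valK.
split; first by rewrite Eh Eh' sumE.
move=> i; have := hdeg i (ltn_ord i); rewrite -Eh /d append_familyl.
set q := \sum_(i < s) _; have [_ _ fi] := msize_hypersurface (hf i).
rewrite /mpdeg (negPf (fN0 i)) fi /=; have [->|h0 hp] := eqVneq (h' i) 0.
  by move=> _; case: ifP.
have q0 : q != 0.
  by apply: contraNneq h0 => q0; rewrite -msize_poly_eq0 -leqn0 (leq_trans hp) // q0 msize0.
rewrite (negPf q0) lee_fin; move: h0 q0 hp; rewrite -!msize_poly_eq0.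
set a := msize (h' i); set b := msize q.
by rewrite -PoszD lez_nat; lia.
Qed.

Theorem theorem4p2 (R : realType) (n s : nat) (hs : (1 <= s <= n)%N)
    (k : 'I_s -> nat) (f : 'I_s -> {mpoly R[i][n]})
    (hdeg : forall i, hypersurface_of_degree (f i) (k i))
    (hsqf : forall i, without_multiple_factors (f i))
    (hint : sufficiently_intersect k f) :
  is_Hbase f.
Proof.
have /andP[_ sn] := hs.
exact: Hbase_of_sufficiently_intersect (@complex_uncountable R) sn hdeg hint.
Qed.
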